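(* Let $\mathcal C$ be a finite $2$-Calabi–Yau triangulated category and let $(\mathscr X,\mathscr Y)$ be a cotorsion pair in $\mathcal C$ with core $\mathcal I=\mathrm{add}\, I$, where $I$ is a rigid object. Then there is an equivalence of abelian categories $$\underline{\mathcal H}\simeq \mathrm{mod}\,\mathrm{End}\, I,$$ where $\underline{\mathcal H}$ is the heart of the cotorsion pair $(\mathscr X,\mathscr Y)$.
   Context: $\mathbb K$ is an algebraically closed field of characteristic zero. All categories are $\mathbb K$-linear, Hom-finite, Krull–Schmidt additive categories. A subcategory means a full subcategory closed under finite direct sums and direct summands; $\mathrm{add}\,I$ is the additive closure of $I$. A triangulated category $\mathcal C$ with shift $[1]$ is $2$-Calabi–Yau if there are functorial isomorphisms $\mathrm{Hom}(X,Y)\simeq D\mathrm{Hom}(Y,X[2])$ with $D=\mathrm{Hom}_{\mathbb K}(-,\mathbb K)$, and finite if it has only finitely many indecomposable objects up to isomorphism. $\mathrm{Ext}^1(X,Y)=\mathrm{Hom}(X,Y[1])$; an object $I$ is rigid if $\mathrm{Ext}^1(I,I)=0$. $\mathscr X*\mathscr Y$ consists of all $M$ in a triangle $X\to M\to Y\to X[1]$ with $X\in\mathscr X$, $Y\in\mathscr Y$. A cotorsion pair in $\mathcal C$ is a pair $(\mathscr X,\mathscr Y)$ of subcategories with $\mathrm{Ext}^1_{\mathcal C}(\mathscr X,\mathscr Y)=0$ and $\mathcal C=\mathscr X*\mathscr Y[1]$; its core is $\mathcal I=\mathscr X\cap\mathscr Y$. Let $\mathcal H=(\mathscr X[-1]*\mathcal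 I)\cap(\mathcal I*\mathscr Y[1])$. The heart $\underline{\mathcal H}=\mathcal H/\mathcal I$ is the quotient of $\mathcal H$ by the ideal of morphisms factoring through objects of $\mathcal I$ (it is abelian by a theorem of Nakaoka). $\mathrm{mod}\,\mathrm{End}\,I$ is the category of finitely generated modules over the endomorphism algebra of $I$. *)

(* Defs.v *)
From HB Require Import structures.
From mathcomp Require Import all_boot all_algebra.
From mathcomp Require Import boolp.

Set Implicit Arguments.
Unset Strict Implicit.
Unset Printing Implicit Defensive.

Import GRing.Theory.
Local Open Scope ring_scope.
Local Open Scope quotient_scope.

Definition fin_gen (R : pzRingType) (M : lmodType R) : Prop :=
  exists s : seq M, forall m : M,
    exists c : 'I_(size s) -> R, m = \sum_i c i *: s`_i.

Reserved Notation "g \om f" (at level 40, left associativity).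

Record linCat (K : fieldType) := LinCat {
  ob :> Type;
  hom : ob -> ob -> lmodType K;
  idm : forall X, hom X X;
  comp : forall X Y Z, hom Y Z -> hom X Y -> hom X Z
    where "g \om f" := (comp g f);
  compA : forall X Y Z T (h : hom Z T) (g : hom Y Z) (f : hom X Y),
    h \om (g \om f) = (h \om g) \om f;
  comp1m : forall X Y (f : hom X Y), idm Y \om f = f;
  compm1 : forall X Y (f : hom X Y), f \om idm X = f;
  comp_linl : forall X Y Z (f : hom X Y),
    linear ((fun g => g \om f) : hom Y Z -> hom X Z);
  comp_linr : forall X Y Z (g : hom Y Z),
    linear ((fun f => g \om f) : hom X Y -> hom X Z)
}.

Arguments hom {K _} X Y.
Arguments idm {K _} X.
Notation "g \om f" := (comp g f) : ring_scope.

Record linFunctor (K : fieldType) (C D : linCat K) := LinFunctor {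
  fobj :> C -> D;
  fmap : forall X Y : C, {linear hom X Y -> hom (fobj X) (fobj Y)};
  fmap_id : forall X : C, fmap X X (idm X) = idm (fobj X);
  fmap_comp : forall (X Y Z : C) (g : hom Y Z) (f : hom X Y),
    fmap X Z (g \om f) = fmap Y Z g \om fmap X Y f
}.

Arguments fmap {K C D} F {X Y} : rename.

Section LinCatTheory.
Variables (K : fieldType) (C : linCat K).

Definition is_iso (X Y : C) (f : hom X Y) : Prop :=
  exists g : hom Y X, g \om f = idm X /\ f \om g = idm Y.

Definition isomorphic (X Y : C) : Prop := exists f : hom X Y, is_iso f.

Definition is_zero (X : C) : Prop := idm X = 0.

(* For n = 0 the condition says that Z is a zero object, and for n = 1 that Z
   is isomorphic to the only term of W. *)
Definition is_dsum n (W : 'I_n -> C) (Z : C) : Prop :=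
  exists (inj : forall k, hom (W k) Z) (proj : forall k, hom Z (W k)),
    [/\ forall k, proj k \om inj k = idm (W k),
        forall k l, k != l -> proj l \om inj k = 0
      & \sum_k inj k \om proj k = idm Z].

Definition summand (X Z : C) : Prop :=
  exists n (W : 'I_n -> C), is_dsum W Z /\ exists k, W k = X.

Definition additive_cat : Prop :=
  forall n (W : 'I_n -> C), exists Z, is_dsum W Z.

Definition indecomposable (Z : C) : Prop :=
  ~ is_zero Z /\ forall W : 'I_2 -> C, is_dsum W Z -> exists k, is_zero (W k).

Definition local_end (X : C) : Prop :=
  ~ is_zero X /\ forall f : hom X X, is_iso f \/ is_iso (idm X - f).

Definition hom_finite : Prop := forall X Y : C, fin_gen (hom X Y).

Definition krull_schmidt : Prop :=
  forall Z, exists n (W : 'I_n -> C), is_dsum W Z /\ forall k, local_end (W k).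

Definition finite_cat : Prop :=
  exists n (W : 'I_n -> C),
    forall Z, indecomposable Z -> exists k, isomorphic (W k) Z.

Definition is_subcat (P : C -> Prop) : Prop :=
  (forall n (W : 'I_n -> C) Z, is_dsum W Z -> (forall k, P (W k)) -> P Z) /\
  (forall X Z, summand X Z -> P Z -> P X).

Record subcat := Subcat { smem :> C -> Prop; smemP : is_subcat smem }.

Lemma subcatI_subproof (P Q : subcat) : is_subcat (fun X => P X /\ Q X).
Proof.
have [Pd Ps] := smemP P; have [Qd Qs] := smemP Q; split.
  move=> n W Z WZ PQ; split; [apply: Pd WZ _|apply: Qd WZ _] => k;
    by have [] := PQ k.
by move=> X Z XZ [PZ QZ]; split; [apply: Ps XZ PZ|apply: Qs XZ QZ].
Qed.

Definition subcatI (P Q : subcat) : subcat := Subcat (subcatI_subproof P Q).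

Definition add_closure (I X : C) : Prop :=
  exists n Z, is_dsum (fun _ : 'I_n => I) Z /\ summand X Z.

Definition is_kernel (A X Y : C) (k : hom A X) (f : hom X Y) : Prop :=
  f \om k = 0 /\
  forall T (g : hom T X), f \om g = 0 -> exists! u : hom T A, k \om u = g.

Definition is_cokernel (X Y B : C) (f : hom X Y) (c : hom Y B) : Prop :=
  c \om f = 0 /\
  forall T (g : hom Y T), g \om f = 0 -> exists! u : hom B T, u \om c = g.

Definition mono (X Y : C) (f : hom X Y) : Prop :=
  forall T (g h : hom T X), f \om g = f \om h -> g = h.

Definition epi (X Y : C) (f : hom X Y) : Prop :=
  forall T (g h : hom Y T), g \om f = h \om f -> g = h.

Definition abelian_cat : Prop :=
  [/\ additive_cat,
      forall (X Y : C) (f : hom X Y), exists A (k : hom A X), is_kernel k f,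
      forall (X Y : C) (f : hom X Y), exists B (c : hom Y B), is_cokernel f c,
      forall (X Y : C) (f : hom X Y), mono f ->
        exists Z (g : hom Y Z), is_kernel f g
    & forall (X Y : C) (f : hom X Y), epi f ->
        exists Z (g : hom Z X), is_cokernel g f].

Definition idF : linFunctor C C :=
  @LinFunctor K C C id (fun X Y => idfun) (fun _ => erefl)
    (fun _ _ _ _ _ => erefl).

End LinCatTheory.

Section Functors.
Variable K : fieldType.

Lemma compF_id (C D E : linCat K) (G : linFunctor D E) (F : linFunctor C D) X :
  (fmap G \o fmap F) (idm X) = idm (G (F X)).
Proof. by rewrite /= !fmap_id. Qed.

Lemma compF_comp (C D E : linCat K) (G : linFunctor D E) (F : linFunctor C D)
    (X Y Z : C) (g : hom Y Z) (f : hom X Y) :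
  (fmap G \o fmap F) (g \om f) =
  (fmap G \o fmap F) g \om (fmap G \o fmap F) f.
Proof. by rewrite /= !fmap_comp. Qed.

Definition compF (C D E : linCat K) (G : linFunctor D E) (F : linFunctor C D) :
    linFunctor C E :=
  @LinFunctor K C E (G \o F) (fun X Y => fmap G \o fmap F)
    (@compF_id C D E G F) (@compF_comp C D E G F).

Definition nat_iso (C D : linCat K) (F G : linFunctor C D) : Prop :=
  exists eta : forall X : C, hom (F X) (G X),
    (forall X, is_iso (eta X)) /\
    (forall (X Y : C) (f : hom X Y), eta Y \om fmap F f = fmap G f \om eta X).

Definition is_equivalence (C D : linCat K) (F : linFunctor C D) : Prop :=
  exists G : linFunctor D C,
    nat_iso (compF G F) (idF C) /\ nat_iso (compF F G) (idF D).

Definition equivalent (C D : linCat K) : Prop :=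
  exists F : linFunctor C D, is_equivalence F.

End Functors.

Section FullSub.
Variables (K : fieldType) (C : linCat K) (P : C -> Prop).

Definition fullsub : linCat K :=
  @LinCat K {X : C | P X} (fun X Y => hom (sval X) (sval Y))
    (fun X => idm (sval X)) (fun X Y Z g f => g \om f)
    (fun _ _ _ _ _ _ _ => compA _ _ _) (fun _ _ _ => comp1m _)
    (fun _ _ _ => compm1 _)
    (fun X Y Z => @comp_linl K C (sval X) (sval Y) (sval Z))
    (fun X Y Z => @comp_linr K C (sval X) (sval Y) (sval Z)).

End FullSub.

Record ideal (K : fieldType) (C : linCat K) := Ideal {
  imem : forall X Y : C, hom X Y -> Prop;
  imem0 : forall X Y : C, imem (0 : hom X Y);
  imem_lin : forall (X Y : C) (a : K) (f g : hom X Y),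
    imem f -> imem g -> imem (a *: f + g);
  imem_compl : forall (X Y Z : C) (g : hom Y Z) (f : hom X Y),
    imem f -> imem (g \om f);
  imem_compr : forall (X Y Z : C) (g : hom Y Z) (f : hom X Y),
    imem g -> imem (g \om f)
}.

Section Quotient.
Variables (K : fieldType) (C : linCat K) (J : ideal C).

Definition ideal_pred (X Y : C) : {pred hom X Y} := fun f => `[< imem J f >].
Arguments ideal_pred : clear implicits.

Lemma ideal_zmod_closed (X Y : C) : zmod_closed (ideal_pred X Y).
Proof.
split=> [|f g]; first exact/asboolP/imem0.
move=> /asboolP Jf /asboolP Jg; apply/asboolP.
by rewrite addrC -scaleN1r; apply: imem_lin.
Qed.

HB.instance Definition _ (X Y : C) :=
  GRing.isZmodClosed.Build (hom X Y) (ideal_pred X Y) (@ideal_zmod_closed X Y).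

Definition qhom (X Y : C) := Quotient.quot (ideal_pred X Y).

HB.instance Definition _ (X Y : C) := GRing.Zmodule.on (qhom X Y).

Definition qpi (X Y : C) (f : hom X Y) : qhom X Y := \pi_(qhom X Y) f.

Lemma qpi_eq (X Y : C) (f g : hom X Y) : imem J (f - g) -> qpi f = qpi g.
Proof. by move=> Jfg; apply/eqP; rewrite -Quotient.idealrBE; apply/asboolP. Qed.

Lemma qpi_eqP (X Y : C) (f g : hom X Y) : qpi f = qpi g -> imem J (f - g).
Proof. by move=> /eqP; rewrite -Quotient.idealrBE => /asboolP. Qed.

Lemma qpiD (X Y : C) (f g : hom X Y) : qpi (f + g) = qpi f + qpi g.
Proof. by rewrite /qpi !piE. Qed.

Lemma qreprK (X Y : C) (u : qhom X Y) : qpi (repr u) = u.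
Proof. exact: reprK. Qed.

Lemma qrepr (X Y : C) (f : hom X Y) : imem J (repr (qpi f) - f).
Proof. exact/qpi_eqP/qreprK. Qed.

Definition qscale (X Y : C) (a : K) (u : qhom X Y) : qhom X Y :=
  qpi (a *: repr u).

Lemma qpiZ (X Y : C) a (f : hom X Y) : qscale a (qpi f) = qpi (a *: f).
Proof.
apply: qpi_eq; rewrite -scalerBr -[_ *: _]addr0.
by apply: imem_lin (imem0 _ _ _); apply: qrepr.
Qed.

Lemma qscaleA (X Y : C) a b (u : qhom X Y) :
  qscale a (qscale b u) = qscale (a * b) u.
Proof. by rewrite -[u]qreprK !qpiZ scalerA. Qed.

Lemma qscale1 (X Y : C) : left_id 1 (@qscale X Y).
Proof. by move=> u; rewrite -[u]qreprK qpiZ scale1r. Qed.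

Lemma qscaleDr (X Y : C) : right_distributive (@qscale X Y) +%R.
Proof.
by move=> a u v; rewrite -[u]qreprK -[v]qreprK -qpiD !qpiZ scalerDr qpiD.
Qed.

Lemma qscaleDl (X Y : C) (u : qhom X Y) :
  {morph (@qscale X Y)^~ u : a b / a + b}.
Proof. by move=> a b; rewrite -[u]qreprK !qpiZ scalerDl qpiD. Qed.

HB.instance Definition _ (X Y : C) :=
  GRing.Zmodule_isLmodule.Build K (qhom X Y)
    (@qscaleA X Y) (@qscale1 X Y) (@qscaleDr X Y) (@qscaleDl X Y).

Definition qcomp (X Y Z : C) (u : qhom Y Z) (v : qhom X Y) : qhom X Z :=
  qpi (repr u \om repr v).

Lemma qpi_comp (X Y Z : C) (g : hom Y Z) (f : hom X Y) :
  qcomp (qpi g) (qpi f) = qpi (g \om f).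
Proof.
apply: qpi_eq; set g' := repr _; set f' := repr _.
have -> : g' \om f' - g \om f = 1 *: ((g' - g) \om f') + g \om (f' - f).
  have := comp_linl f' (-1) g g'; have := comp_linr g (-1) f f'.
  rewrite !scaleN1r scale1r ![- _ + _]addrC => -> ->.
  by rewrite addrA subrK.
apply: imem_lin; [apply: imem_compr|apply: imem_compl]; exact: qrepr.
Qed.

Lemma qcompA (X Y Z T : C) (h : qhom Z T) (g : qhom Y Z) (f : qhom X Y) :
  qcomp h (qcomp g f) = qcomp (qcomp h g) f.
Proof. by rewrite -[h]qreprK -[g]qreprK -[f]qreprK !qpi_comp compA. Qed.

Lemma qcomp1m (X Y : C) (f : qhom X Y) : qcomp (qpi (idm Y)) f = f.
Proof. by rewrite -[f]qreprK qpi_comp comp1m. Qed.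

Lemma qcompm1 (X Y : C) (f : qhom X Y) : qcomp f (qpi (idm X)) = f.
Proof. by rewrite -[f]qreprK qpi_comp compm1. Qed.

Lemma qpi_lin (X Y : C) a (f g : hom X Y) :
  a *: qpi f + qpi g = qpi (a *: f + g).
Proof. by rewrite qpiD -qpiZ. Qed.

Lemma qcomp_linl (X Y Z : C) (f : qhom X Y) :
  linear ((fun g => qcomp g f) : qhom Y Z -> qhom X Z).
Proof.
move=> a g h; rewrite -[f]qreprK -[g]qreprK -[h]qreprK.
by rewrite qpi_lin !qpi_comp qpi_lin comp_linl.
Qed.

Lemma qcomp_linr (X Y Z : C) (g : qhom Y Z) :
  linear ((fun f => qcomp g f) : qhom X Y -> qhom X Z).
Proof.
move=> a f h; rewrite -[f]qreprK -[g]qreprK -[h]qreprK.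
by rewrite qpi_lin !qpi_comp qpi_lin comp_linr.
Qed.

Definition quotcat : linCat K :=
  @LinCat K C qhom (fun X => qpi (idm X)) qcomp
    qcompA qcomp1m qcompm1 qcomp_linl qcomp_linr.

End Quotient.

Section FactorIdeal.
Variables (K : fieldType) (C : linCat K).

Definition factors (P : C -> Prop) (X Y : C) (f : hom X Y) : Prop :=
  exists Z (h : hom Z Y) (g : hom X Z), P Z /\ f = h \om g.

Variables (addC : additive_cat C) (P : subcat C).

Lemma comp0m (X Y Z : C) (f : hom X Y) : (0 : hom Y Z) \om f = 0.
Proof.
by have := comp_linl f (-1) (0 : hom Y Z) 0; rewrite !scaleN1r !addNr.
Qed.

Lemma compDl (X Y Z : C) (f : hom X Y) (g h : hom Y Z) :
  (g + h) \om f = g \om f + h \om f.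
Proof. by have := comp_linl f 1 g h; rewrite !scale1r. Qed.

Lemma compDr (X Y Z : C) (f : hom Y Z) (g h : hom X Y) :
  f \om (g + h) = f \om g + f \om h.
Proof. by have := comp_linr f 1 g h; rewrite !scale1r. Qed.

Lemma compm0 (X Y Z : C) (f : hom Y Z) : f \om (0 : hom X Y) = 0.
Proof.
by have := comp_linr f (-1) (0 : hom X Y) 0; rewrite !scaleN1r !addNr.
Qed.

Lemma compZl (X Y Z : C) a (f : hom X Y) (g : hom Y Z) :
  (a *: g) \om f = a *: (g \om f).
Proof. by have := comp_linl f a g 0; rewrite !addr0 comp0m addr0. Qed.

Lemma factors0 (X Y : C) : factors P (0 : hom X Y).
Proof.
have [Pd _] := smemP P.
have W : 'I_0 -> C by case.
have [Z WZ] := addC W.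
exists Z, 0, 0; split; last by rewrite comp0m.
by apply: Pd WZ _ => -[].
Qed.

Lemma factors_lin (X Y : C) (a : K) (f g : hom X Y) :
  factors P f -> factors P g -> factors P (a *: f + g).
Proof.
have [Pd _] := smemP P.
move=> [Z1 [h1 [g1 [PZ1 ->]]]] [Z2 [h2 [g2 [PZ2 ->]]]].
pose W (k : 'I_2) := if val k is 0%N then Z1 else Z2.
have [Z WZ] := addC W.
have PZ : P Z by apply: Pd WZ _; case=> -[].
have [i [p [pi1 pi0 _]]] := WZ.
pose k0 : 'I_2 := ord0; pose k1 : 'I_2 := lift ord0 ord0.
pose i0 : hom Z1 Z := i k0; pose i1 : hom Z2 Z := i k1.
pose p0 : hom Z Z1 := p k0; pose p1 : hom Z Z2 := p k1.
have e00 : p0 \om i0 = idm Z1 := pi1 k0.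
have e11 : p1 \om i1 = idm Z2 := pi1 k1.
have e01 : p1 \om i0 = 0 := pi0 k0 k1 isT.
have e10 : p0 \om i1 = 0 := pi0 k1 k0 isT.
exists Z, (a *: (h1 \om p0) + h2 \om p1), (i0 \om g1 + i1 \om g2); split=> //.
have mid T U (h : hom T Y) (q : hom Z T) (j : hom U Z) (k : hom X U) :
    h \om q \om (j \om k) = h \om (q \om j) \om k by rewrite !compA.
rewrite compDl !compDr !compZl !mid e00 e11 e01 e10.
by rewrite !compm1 !compm0 !comp0m scaler0 addr0 add0r.
Qed.

Lemma factors_compl (X Y Z : C) (g : hom Y Z) (f : hom X Y) :
  factors P f -> factors P (g \om f).
Proof.
by move=> [T [h [k [PT ->]]]]; exists T, (g \om h), k; rewrite compA.
Qed.

Lemma factors_compr (X Y Z : C) (g : hom Y Z) (f : hom X Y) :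
  factors P g -> factors P (g \om f).
Proof.
by move=> [T [h [k [PT ->]]]]; exists T, h, (k \om f); rewrite compA.
Qed.

Definition factor_ideal : ideal C :=
  @Ideal K C (factors P) factors0 factors_lin factors_compl factors_compr.

End FactorIdeal.

Definition ideal_restr (K : fieldType) (C : linCat K) (J : ideal C)
    (P : C -> Prop) : ideal (fullsub P) :=
  @Ideal K (fullsub P) (fun X Y => @imem K C J (sval X) (sval Y))
    (fun X Y => @imem0 K C J (sval X) (sval Y))
    (fun X Y => @imem_lin K C J (sval X) (sval Y))
    (fun X Y Z => @imem_compl K C J (sval X) (sval Y) (sval Z))
    (fun X Y Z => @imem_compr K C J (sval X) (sval Y) (sval Z)).

(* The shift is only required to be an auto-equivalence; an automorphism is a
   special case. *)
Record triCat (K : fieldType) := TriCat {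
  tcat :> linCat K;
  tadd : additive_cat tcat;
  shift : linFunctor tcat tcat;
  shift_equiv : is_equivalence shift;
  dist : forall X Y Z : tcat,
    hom X Y -> hom Y Z -> hom Z (shift X) -> Prop;
  dist_iso : forall (X Y Z X' Y' Z' : tcat)
      (f : hom X Y) (g : hom Y Z) (h : hom Z (shift X))
      (f' : hom X' Y') (g' : hom Y' Z') (h' : hom Z' (shift X'))
      (a : hom X X') (b : hom Y Y') (c : hom Z Z'),
    is_iso a -> is_iso b -> is_iso c ->
    b \om f = f' \om a -> c \om g = g' \om b ->
    fmap shift a \om h = h' \om c ->
    dist f g h -> dist f' g' h';
  dist_id : forall X Z : tcat, is_zero Z ->
    dist (idm X) (0 : hom X Z) (0 : hom Z (shift X));
  dist_ex : forall (X Y : tcat) (f : hom X Y),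
    exists Z (g : hom Y Z) (h : hom Z (shift X)), dist f g h;
  dist_rot : forall (X Y Z : tcat)
      (f : hom X Y) (g : hom Y Z) (h : hom Z (shift X)),
    dist f g h <-> dist g h (- fmap shift f);
  dist_mor : forall (X Y Z X' Y' Z' : tcat)
      (f : hom X Y) (g : hom Y Z) (h : hom Z (shift X))
      (f' : hom X' Y') (g' : hom Y' Z') (h' : hom Z' (shift X'))
      (a : hom X X') (b : hom Y Y'),
    dist f g h -> dist f' g' h' -> b \om f = f' \om a ->
    exists c : hom Z Z', c \om g = g' \om b /\ fmap shift a \om h = h' \om c;
  dist_oct : forall (X Y Z X' Y' Z' : tcat)
      (f : hom X Y) (f1 : hom Y Z') (f2 : hom Z' (shift X))
      (g : hom Y Z) (g1 : hom Z X') (g2 : hom X' (shift Y))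
      (h1 : hom Z Y') (h2 : hom Y' (shift X)),
    dist f f1 f2 -> dist g g1 g2 -> dist (g \om f) h1 h2 ->
    exists (u : hom Z' Y') (v : hom Y' X'),
      [/\ dist u v (fmap shift f1 \om g2),
          u \om f1 = h1 \om g, h2 \om u = f2,
          v \om h1 = g1 & g2 \om v = fmap shift f \om h2]
}.

Arguments shift {K} _.
Notation "X '[+1]'" := (shift _ X) (at level 2, format "X [+1]") : ring_scope.

Section Triangulated.
Variables (K : fieldType) (C : triCat K).
Implicit Types P Q : C -> Prop.

Definition calabi_yau2 : Prop :=
  exists phi : forall X Y : C, hom X Y -> {scalar hom Y (X[+1][+1])},
  [/\ forall (X Y : C) (a : K) (f g : hom X Y) h,
        phi X Y (a *: f + g) h = a * phi X Y f h + phi X Y g h,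
      forall X Y : C, bijective (phi X Y)
    & forall (X Y X' Y' : C) (a : hom X' X) (b : hom Y Y') (f : hom X Y)
          (h : hom Y' (X'[+1][+1])),
        phi X' Y' (b \om f \om a) h =
        phi X Y f (fmap (shift C) (fmap (shift C) a) \om h \om b)].

Definition Ext1_zero (X Y : C) : Prop := forall f : hom X (Y[+1]), f = 0.

Definition rigid (I : C) : Prop := Ext1_zero I I.

Definition star P Q : C -> Prop := fun M =>
  exists (X Y : C) (f : hom X M) (g : hom M Y) (h : hom Y (X[+1])),
    [/\ P X, Q Y & dist f g h].

Definition shiftP P : C -> Prop := fun M =>
  exists2 N, P N & isomorphic M (N[+1]).

(* P[-1]: X is isomorphic to N[-1] iff X[1] is isomorphic to N. *)
Definition unshiftP P : C -> Prop := fun M =>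
  exists2 N, P N & isomorphic (M[+1]) N.

Definition cotorsion_pair (X Y : subcat C) : Prop :=
  (forall A B, X A -> Y B -> Ext1_zero A B) /\ (forall M, star X (shiftP Y) M).

Definition core (X Y : subcat C) : subcat C := subcatI X Y.

Definition heart_mem (X Y : subcat C) : C -> Prop := fun M =>
  star (unshiftP X) (core X Y) M /\ star (core X Y) (shiftP Y) M.

(* The factorisations are through objects of the core in C; as the core is
   contained in the subcategory heart_mem X Y, this is the same as factoring
   inside that subcategory. *)
Definition heart (X Y : subcat C) : linCat K :=
  quotcat (ideal_restr (factor_ideal (@tadd K C) (core X Y)) (heart_mem X Y)).

End Triangulated.

Section EndRing.
Variables (K : fieldType) (C : linCat K) (I : C).

(* The zero object has the zero ring as endomorphism ring, hence a pzRingType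
   and not an algType, which excludes 1 = 0. *)
Definition endo : Type := hom I I.

HB.instance Definition _ := GRing.Lmodule.copy endo (hom I I).

Lemma endoDl : left_distributive (@comp K C I I I) +%R.
Proof. by move=> f g h; rewrite compDl. Qed.

Lemma endoDr : right_distributive (@comp K C I I I) +%R.
Proof. by move=> f g h; rewrite compDr. Qed.

HB.instance Definition _ :=
  GRing.Zmodule_isPzRing.Build endo
    (@compA K C I I I I) (@comp1m K C I I) (@compm1 K C I I) endoDl endoDr.

(* Right End(I)-modules, i.e. left modules over the converse ring; the product
   f * g of End(I) is the composite f \om g, so Hom(I, X) is such a module. *)
Definition rmodule := lmodType endo^c.

Definition mhom (M N : rmodule) : Type := {linear M -> N}.

HB.instance Definition _ (M N : rmodule) := gen_eqMixin (mhom M N).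
HB.instance Definition _ (M N : rmodule) := gen_choiceMixin (mhom M N).

Lemma mhom_ext (M N : rmodule) (f g : {linear M -> N}) : f =1 g -> f = g.
Proof.
move: f g => [f cf] [g cg] /= /funext fg; move: cf cg; rewrite fg.
move=> [[f1] [f2]] [[g1] [g2]].
by rewrite (Prop_irrelevance f1 g1) (Prop_irrelevance f2 g2).
Qed.

Definition mhom_zero (M N : rmodule) : mhom M N := \0 : {linear M -> N}.
Definition mhom_add (M N : rmodule) (f g : {linear M -> N}) : mhom M N :=
  (f \+ g) : {linear M -> N}.
Definition mhom_opp (M N : rmodule) (f : {linear M -> N}) : mhom M N :=
  (\- f) : {linear M -> N}.

Lemma mhom_addA (M N : rmodule) : associative (@mhom_add M N).
Proof. by move=> f g h; apply: mhom_ext => x /=; rewrite addrA. Qed.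
Lemma mhom_addC (M N : rmodule) : commutative (@mhom_add M N).
Proof. by move=> f g; apply: mhom_ext => x /=; rewrite addrC. Qed.
Lemma mhom_add0 (M N : rmodule) :
  left_id (mhom_zero M N) (@mhom_add M N).
Proof. by move=> f; apply: mhom_ext => x /=; rewrite add0r. Qed.
Lemma mhom_addN (M N : rmodule) :
  left_inverse (mhom_zero M N) (@mhom_opp M N) (@mhom_add M N).
Proof. by move=> f; apply: mhom_ext => x /=; rewrite addNr. Qed.

HB.instance Definition _ (M N : rmodule) :=
  GRing.isZmodule.Build (mhom M N)
    (@mhom_addA M N) (@mhom_addC M N) (@mhom_add0 M N) (@mhom_addN M N).

Definition scal (a : K) : endo^c := a *: idm I.

Lemma scalC (a : K) (e : endo^c) : scal a * e = e * scal a.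
Proof.
rewrite [LHS](_ : _ = (e : hom I I) \om (a *: idm I)) //.
rewrite [RHS](_ : _ = (a *: idm I) \om (e : hom I I)) //.
rewrite compZl comp1m; have := comp_linr (e : hom I I) a (idm I) 0.
by rewrite !addr0 compm0 addr0 compm1.
Qed.

Lemma scalM (a b : K) : scal a * scal b = scal (a * b).
Proof.
rewrite [LHS](_ : _ = (scal b : hom I I) \om (scal a : hom I I)) //.
by rewrite /scal compZl comp1m scalerA mulrC.
Qed.

Definition mhom_scale_fun (M N : rmodule) (a : K) (f : {linear M -> N}) :
  M -> N := fun x => scal a *: f x.

Lemma mhom_scale_linear (M N : rmodule) a (f : {linear M -> N}) :
  linear (mhom_scale_fun a f).
Proof.
move=> e x y; rewrite /mhom_scale_fun linearP scalerDr.
by rewrite !(scalerA (_ : endo^c)) scalC.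
Qed.

HB.instance Definition _ (M N : rmodule) a (f : {linear M -> N}) :=
  GRing.isLinear.Build endo^c M N *:%R (mhom_scale_fun a f)
    (mhom_scale_linear a f).

Definition mhom_scale (M N : rmodule) (a : K) (f : mhom M N) : mhom M N :=
  mhom_scale_fun a (f : {linear M -> N}) : {linear M -> N}.

Lemma mhom_scaleA (M N : rmodule) a b (f : mhom M N) :
  mhom_scale a (mhom_scale b f) = mhom_scale (a * b) f.
Proof.
by apply: mhom_ext => x /=; rewrite /mhom_scale_fun /= scalerA scalM.
Qed.

Lemma mhom_scale1 (M N : rmodule) : left_id 1 (@mhom_scale M N).
Proof.
move=> f; apply: mhom_ext => x /=.
by rewrite /mhom_scale_fun /scal scale1r (scale1r (_ : N)).
Qed.

Lemma mhom_scaleDr (M N : rmodule) : right_distributive (@mhom_scale M N) +%R.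
Proof.
by move=> a f g; apply: mhom_ext => x /=; rewrite /mhom_scale_fun /= scalerDr.
Qed.

Lemma mhom_scaleDl (M N : rmodule) (f : mhom M N) :
  {morph (@mhom_scale M N)^~ f : a b / a + b}.
Proof.
move=> a b; apply: mhom_ext => x /=.
by rewrite /mhom_scale_fun /scal scalerDl scalerDl.
Qed.

HB.instance Definition _ (M N : rmodule) :=
  GRing.Zmodule_isLmodule.Build K (mhom M N)
    (@mhom_scaleA M N) (@mhom_scale1 M N) (@mhom_scaleDr M N)
    (@mhom_scaleDl M N).

Definition mhom_id (M : rmodule) : mhom M M := idfun : {linear M -> M}.
Definition mhom_comp (M N L : rmodule) (g : mhom N L) (f : mhom M N) :
  mhom M L := ((g : {linear N -> L}) \o (f : {linear M -> N}))
    : {linear M -> L}.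

Lemma mhom_compA (M N L T : rmodule)
    (h : mhom L T) (g : mhom N L) (f : mhom M N) :
  mhom_comp h (mhom_comp g f) = mhom_comp (mhom_comp h g) f.
Proof. by apply: mhom_ext. Qed.
Lemma mhom_comp1m (M N : rmodule) (f : mhom M N) :
  mhom_comp (mhom_id N) f = f.
Proof. by apply: mhom_ext. Qed.
Lemma mhom_compm1 (M N : rmodule) (f : mhom M N) :
  mhom_comp f (mhom_id M) = f.
Proof. by apply: mhom_ext. Qed.
Lemma mhom_comp_linl (M N L : rmodule) (f : mhom M N) :
  linear ((fun g => mhom_comp g f) : mhom N L -> mhom M L).
Proof. by move=> a g h; apply: mhom_ext. Qed.
Lemma mhom_comp_linr (M N L : rmodule) (g : mhom N L) :
  linear ((fun f => mhom_comp g f) : mhom M N -> mhom M L).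
Proof.
move=> a f h; apply: mhom_ext => x /=.
by rewrite raddfD /= /mhom_scale_fun /= linearZ.
Qed.

Definition rmod_cat : linCat K :=
  @LinCat K rmodule mhom mhom_id mhom_comp mhom_compA mhom_comp1m
    mhom_compm1 mhom_comp_linl mhom_comp_linr.

Definition mod_End : linCat K :=
  @fullsub K rmod_cat (fun M : rmodule => fin_gen M).

End EndRing.

(* Main.v *)
From HB Require Import structures.
From mathcomp Require Import all_boot all_algebra.
From mathcomp Require Import boolp.
Require Import Defs.

Set Implicit Arguments.
Unset Strict Implicit.
Unset Printing Implicit Defensive.

Import GRing.Theory.
Local Open Scope ring_scope.
Local Open Scope quotient_scope.

(** The equivalence is induced by Hom(I, -[1]).  Write J, J0, J1 for objects of
the core add I.

The 2-Calabi-Yau property makes the vanishing of Ext^1 symmetric ([ext1_sym]),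
so Ext^1 vanishes between X and Y in both directions.  For A in X, the
cotorsion triangle of A[1] rotates to A -> J -> A1 -> A[1] with A1 in X
([cosyzygy_ex]), and A |-> A1 is a suspension on X which is fully faithful
modulo the core.  Finiteness makes it dense up to direct summands: the n-fold
suspensions form a decreasing sequence of subcategories, each determined by the
indecomposables that it contains, so the sequence becomes stationary, and
desuspending shows that it is already stationary at n = 0 ([all_suspended]).
Consequently every A in X also lies in a triangle A' -> J -> A -> A'[1] with
A' in X ([syzygy_ex]).

An object M of the heart lies in triangles M -> J0 -> A -> M[1] with A in X and
J1 -> M -> D[1] -> J1[1] with D in Y.  The central fact is [shifted_hom_eq0]:
for A in X and N in the heart, a morphism A -> N[1] that vanishes on all
morphisms I -> A is zero.  Indeed it vanishes on J -> A, hence factors as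
A -> A'[1] -> N[1]; the desuspended A' -> N goes to zero in D[1], so it comes
from some A' -> J1; and the composite A -> A'[1] -> J1[1] is zero because
Ext^1(A, J1) = 0.  Applied to the triangle M -> J0 -> A -> M[1], this gives that
the functor is faithful modulo the core and full ([heart_hom_faithful],
[heart_hom_full]).

For density, a module over End I has a presentation coming from a morphism
J1 -> J0, and completing it to M0 -> J1 -> J0 -> M0[1] gives an M0 with the
right image.  Pushing out the cotorsion triangle X0 -> M0 -> Y0[1] along
X0 -> JX, where JX -> X1 -> X0[1] continues X0 -> JX as above, moves M0 into the
heart and leaves Hom(I, -[1]) unchanged ([heart_presentation]).

Finally mod End I is abelian because End I is finite dimensional
([mod_End_abelian]), and the heart inherits this along the equivalence
([abelian_transport]). *)

(** * Linear categories and equivalences *)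

Section LinCatBasics.
Variables (K : fieldType) (C : linCat K).

Lemma compNl (X Y Z : C) (f : hom X Y) (g : hom Y Z) : (- g) \om f = - (g \om f).
Proof. by rewrite -scaleN1r compZl scaleN1r. Qed.

Lemma compZr (X Y Z : C) a (f : hom Y Z) (g : hom X Y) :
  f \om (a *: g) = a *: (f \om g).
Proof. by have := comp_linr f a g 0; rewrite !addr0 compm0 addr0. Qed.

Lemma compNr (X Y Z : C) (f : hom Y Z) (g : hom X Y) : f \om (- g) = - (f \om g).
Proof. by rewrite -scaleN1r compZr scaleN1r. Qed.

Lemma compBl (X Y Z : C) (f : hom X Y) (g h : hom Y Z) :
  (g - h) \om f = g \om f - h \om f.
Proof. by rewrite compDl compNl. Qed.

Lemma compBr (X Y Z : C) (f : hom Y Z) (g h : hom X Y) :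
  f \om (g - h) = f \om g - f \om h.
Proof. by rewrite compDr compNr. Qed.

Lemma comp_suml (X Y Z : C) n (f : hom X Y) (g : 'I_n -> hom Y Z) :
  (\sum_i g i) \om f = \sum_i (g i \om f).
Proof. exact: (big_morph (fun g => g \om f) (compDl f) (comp0m _ f)). Qed.

Lemma comp_sumr (X Y Z : C) n (f : hom Y Z) (g : 'I_n -> hom X Y) :
  f \om (\sum_i g i) = \sum_i (f \om g i).
Proof. exact: (big_morph (fun g => f \om g) (compDr f) (compm0 _ f)). Qed.

Lemma isomorphic_sym (X Y : C) : isomorphic X Y -> isomorphic Y X.
Proof. by move=> [f [g [gf fg]]]; exists g, f. Qed.

Lemma subcat_iso (P : subcat C) (X Z : C) : isomorphic X Z -> P X -> P Z.
Proof.
move=> [f [g [gf fg]]] PX; have [Pd _] := smemP P.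
apply: (Pd 1%N (fun=> X)) => //; exists (fun=> f), (fun=> g); split=> //.
  by move=> k l; rewrite (ord1 k) (ord1 l) eqxx.
by rewrite big_ord1.
Qed.

Lemma summand_biprod (A B Z : C) (i : hom A Z) (j : hom B Z)
    (p : hom Z A) (q : hom Z B) :
  p \om i = idm A -> q \om j = idm B -> q \om i = 0 -> p \om j = 0 ->
  i \om p + j \om q = idm Z -> summand A Z.
Proof.
move=> pi qj qi pj s; pose W (k : 'I_2) := if val k is 0%N then A else B.
exists 2%N, W; split; last by exists ord0.
exists (fun k : 'I_2 => let: Ordinal m lt := k return hom (W k) Z in
  match m return forall lt : (m < 2)%N, hom (W (Ordinal lt)) Z with
  | 0%N => fun=> i | _.+1 => fun=> j end lt).
exists (fun k : 'I_2 => let: Ordinal m lt := k return hom Z (W k) in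
  match m return forall lt : (m < 2)%N, hom Z (W (Ordinal lt)) with
  | 0%N => fun=> p | _.+1 => fun=> q end lt).
split=> [[[|m] lt] //|[[|m] lt] [[|m'] lt'] //|].
  by case: m lt => [|//] lt; case: m' lt' => [|//] lt'; rewrite -val_eqE.
by rewrite big_ord_recl big_ord1.
Qed.

End LinCatBasics.

Section LinFunctorBasics.
Variables (K : fieldType) (C D : linCat K) (F : linFunctor C D) (X Y : C).

Lemma fmap0 : fmap F (0 : hom X Y) = 0. Proof. exact: raddf0. Qed.

Lemma fmapN (f : hom X Y) : fmap F (- f) = - fmap F f. Proof. exact: raddfN. Qed.

Lemma fmapB (f g : hom X Y) : fmap F (f - g) = fmap F f - fmap F g.
Proof. exact: raddfB. Qed.

Lemma fmap_sum n (f : 'I_n -> hom X Y) :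
  fmap F (\sum_k f k) = \sum_k fmap F (f k).
Proof. exact: raddf_sum. Qed.

End LinFunctorBasics.

Section FullyFaithful.
Variables (K : fieldType) (C D : linCat K) (F : linFunctor C D).

Definition faithful := forall (X Y : C) (f : hom X Y), fmap F f = 0 -> f = 0.

Definition full := forall (X Y : C) (h : hom (F X) (F Y)),
  exists f : hom X Y, fmap F f = h.

Definition ess_surj := forall Z : D, exists X : C, isomorphic (F X) Z.

Lemma faithful_inj : faithful ->
  forall (X Y : C) (f g : hom X Y), fmap F f = fmap F g -> f = g.
Proof.
by move=> Fi X Y f g fg; apply/subr0_eq/Fi; rewrite raddfB /= fg subrr.
Qed.

End FullyFaithful.

Section EquivalenceProps.
Variables (K : fieldType) (C D : linCat K) (F : linFunctor C D).

Lemma nat_iso_id_faithful (G : linFunctor D C) :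
  nat_iso (compF G F) (idF C) -> faithful F.
Proof.
move=> [e [ei en]] X Y f f0; have [e' [e'e ee']] := ei X.
by rewrite -[f]compm1 -ee' compA -(en X Y f) /= f0 raddf0 compm0 comp0m.
Qed.

Lemma equivalence_faithful : is_equivalence F -> faithful F.
Proof. by move=> [G [GF _]]; exact: nat_iso_id_faithful GF. Qed.

Lemma equivalence_ess_surj : is_equivalence F -> ess_surj F.
Proof. by move=> [G [_ [e [ei _]]]] Z; exists (G Z), (e Z); apply: ei. Qed.

End EquivalenceProps.

Lemma equivalence_full (K : fieldType) (C D : linCat K) (F : linFunctor C D) :
  is_equivalence F -> full F.
Proof.
move=> [G [[e [ei en]] FG]] X Y h.
have Gi : faithful G := nat_iso_id_faithful FG.
have [e' [e'e ee']] := ei X; have [d [de ed]] := ei Y.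
exists (e Y \om fmap G h \om e'); apply: (faithful_inj Gi).
have := en X Y (e Y \om fmap G h \om e').
rewrite /= -!compA e'e compm1 => /(congr1 (comp d)).
by rewrite !compA de !comp1m.
Qed.

Section FFEquivalence.
Variables (K : fieldType) (C D : linCat K) (F : linFunctor C D).
Hypotheses (Fi : faithful F) (Ff : full F) (Fe : ess_surj F).

Let G0 (Z : D) : C := sval (cid (Fe Z)).
Let e (Z : D) : hom (F (G0 Z)) Z := sval (cid (svalP (cid (Fe Z)))).
Let e' (Z : D) : hom Z (F (G0 Z)) := sval (cid (svalP (cid (svalP (cid (Fe Z)))))).
Let e'e Z : e' Z \om e Z = idm _.
Proof. by case: (svalP (cid (svalP (cid (svalP (cid (Fe Z))))))). Qed.
Let ee' Z : e Z \om e' Z = idm _.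
Proof. by case: (svalP (cid (svalP (cid (svalP (cid (Fe Z))))))). Qed.

Let lift_fun (X Y : C) (h : hom (F X) (F Y)) : hom X Y := sval (cid (Ff h)).
Let lift_funK (X Y : C) (h : hom (F X) (F Y)) : fmap F (lift_fun h) = h.
Proof. exact: svalP (cid (Ff h)). Qed.

Let G1 (Z T : D) (f : hom Z T) : hom (G0 Z) (G0 T) :=
  lift_fun (e' T \om f \om e Z).

Let G1_linear Z T : linear (@G1 Z T).
Proof.
move=> a f g; apply: (faithful_inj Fi); rewrite linearP !lift_funK.
by rewrite compDr compDl compZr compZl.
Qed.

HB.instance Definition _ Z T :=
  GRing.isLinear.Build K (hom Z T) (hom (G0 Z) (G0 T)) *:%R (@G1 Z T)
    (@G1_linear Z T).

Let G1_id Z : G1 (idm Z) = idm (G0 Z).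
Proof.
by apply: (faithful_inj Fi); rewrite lift_funK compm1 e'e fmap_id.
Qed.

Let G1_comp Z T U (g : hom T U) (f : hom Z T) : G1 (g \om f) = G1 g \om G1 f.
Proof.
apply: (faithful_inj Fi); rewrite fmap_comp !lift_funK !compA.
by rewrite -[_ \om e T \om e' T]compA ee' compm1.
Qed.

Let G : linFunctor D C :=
  @LinFunctor K D C G0 (fun Z T => (@G1 Z T : {linear _ -> _})) G1_id G1_comp.

(** The quasi-inverse picks, by choice, a preimage up to isomorphism of each
object, and transports morphisms through fullness. *)
Lemma ff_equivalence : is_equivalence F.
Proof.
exists G; split.
  exists (fun X => lift_fun (e (F X))); split.
    move=> X; exists (lift_fun (e' (F X))).
    by split; apply: (faithful_inj Fi); rewrite fmap_comp !lift_funK fmap_id ?e'e ?ee'.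
  move=> X Y f /=; apply: (faithful_inj Fi); rewrite !fmap_comp !lift_funK.
  by rewrite !compA ee' comp1m.
exists e; split; first by move=> Z; exists (e' Z); split; [exact: e'e|exact: ee'].
by move=> Z T f /=; rewrite lift_funK !compA ee' comp1m.
Qed.

End FFEquivalence.

Section AbelianTransport.
Variables (K : fieldType) (C D : linCat K) (F : linFunctor C D).
Hypotheses (Fi : faithful F) (Ff : full F) (Fe : ess_surj F).

Lemma reflect_kernel (A X Y : C) (k : hom A X) (f : hom X Y) :
  is_kernel (fmap F k) (fmap F f) -> is_kernel k f.
Proof.
move=> [fk0 ku]; split.
  by apply: (faithful_inj Fi); rewrite fmap_comp fk0 raddf0.
move=> T g fg0.
have Ffg0 : fmap F f \om fmap F g = 0 by rewrite -fmap_comp fg0 raddf0.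
have [u [ug uu]] := ku _ _ Ffg0.
have [v Fv] := Ff u; exists v; split.
  by apply: (faithful_inj Fi); rewrite fmap_comp Fv.
move=> w kw; apply: (faithful_inj Fi).
by rewrite Fv; apply: uu; rewrite -fmap_comp kw.
Qed.

Lemma reflect_cokernel (X Y B : C) (f : hom X Y) (c : hom Y B) :
  is_cokernel (fmap F f) (fmap F c) -> is_cokernel f c.
Proof.
move=> [cf0 cu]; split.
  by apply: (faithful_inj Fi); rewrite fmap_comp cf0 raddf0.
move=> T g gf0.
have Fgf0 : fmap F g \om fmap F f = 0 by rewrite -fmap_comp gf0 raddf0.
have [u [ug uu]] := cu _ _ Fgf0.
have [v Fv] := Ff u; exists v; split.
  by apply: (faithful_inj Fi); rewrite fmap_comp Fv.
move=> w kw; apply: (faithful_inj Fi).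
by rewrite Fv; apply: uu; rewrite -fmap_comp kw.
Qed.

Lemma preserve_mono (X Y : C) (f : hom X Y) : mono f -> mono (fmap F f).
Proof.
move=> fm T; have [T' [t [t' [t't tt']]]] := Fe T => g h fgh.
have [g' Fg'] := Ff (g \om t); have [h' Fh'] := Ff (h \om t).
have gh' : g' = h'.
  apply: fm; apply: (faithful_inj Fi).
  by rewrite !fmap_comp Fg' Fh' !compA fgh.
by rewrite -[g]compm1 -[h]compm1 -tt' !compA -Fg' -Fh' gh'.
Qed.

Lemma preserve_epi (X Y : C) (f : hom X Y) : epi f -> epi (fmap F f).
Proof.
move=> fm T; have [T' [t [t' [t't tt']]]] := Fe T => g h fgh.
have [g' Fg'] := Ff (t' \om g); have [h' Fh'] := Ff (t' \om h).
have gh' : g' = h'.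
  apply: fm; apply: (faithful_inj Fi).
  by rewrite !fmap_comp Fg' Fh' -!compA fgh.
by rewrite -[g]comp1m -[h]comp1m -tt' -!compA -Fg' -Fh' gh'.
Qed.

Lemma kernel_iso_src (E : linCat K) (A A' X Y : E) (k : hom A X) (f : hom X Y)
    (t : hom A' A) : is_iso t -> is_kernel k f -> is_kernel (k \om t) f.
Proof.
move=> [t' [t't tt']] [fk0 ku]; split; first by rewrite compA fk0 comp0m.
move=> T g fg0; have [u [kg uu]] := ku _ _ fg0.
exists (t' \om u); split; first by rewrite !compA -[_ \om t \om t']compA tt' compm1.
by move=> v kv; rewrite (uu (t \om v)) ?compA ?t't ?comp1m.
Qed.

Lemma kernel_iso_tgt (E : linCat K) (A X Y Y' : E) (k : hom A X) (f : hom X Y)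
    (t : hom Y Y') : is_iso t -> is_kernel k f -> is_kernel k (t \om f).
Proof.
move=> [t' [t't tt']] [fk0 ku]; split; first by rewrite -compA fk0 compm0.
move=> T g fg0; apply: ku.
by rewrite -[f]comp1m -t't -!compA [t \om _]compA fg0 compm0.
Qed.

Lemma cokernel_iso_tgt (E : linCat K) (X Y B B' : E) (f : hom X Y) (c : hom Y B)
    (t : hom B B') : is_iso t -> is_cokernel f c -> is_cokernel f (t \om c).
Proof.
move=> [t' [t't tt']] [fk0 ku]; split; first by rewrite -compA fk0 compm0.
move=> T g fg0; have [u [kg uu]] := ku _ _ fg0.
exists (u \om t'); split.
  by rewrite -!compA [t' \om _]compA t't comp1m.
by move=> v kv; rewrite (uu (v \om t)) -?compA ?tt' ?compm1.
Qed.

Lemma cokernel_iso_src (E : linCat K) (X X' Y B : E) (f : hom X Y) (c : hom Y B)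
    (t : hom X' X) : is_iso t -> is_cokernel f c -> is_cokernel (f \om t) c.
Proof.
move=> [t' [t't tt']] [fk0 ku]; split; first by rewrite compA fk0 comp0m.
move=> T g fg0; apply: ku.
by rewrite -[f]compm1 -tt' !compA -[g \om f \om t]compA fg0 comp0m.
Qed.

(** A fully faithful functor reflects kernels and cokernels, and an essentially
surjective one also preserves monomorphisms and epimorphisms; so each universal
object of D is carried back along an isomorphism with an object in the image. *)
Lemma abelian_transport : abelian_cat D -> abelian_cat C.
Proof.
move=> [addD kerD cokD mkD ecD]; split.
- move=> n W; have [Z [i [p [pi1 pi0 ip]]]] := addD n (F \o W).
  have [Z' [t [t' [t't tt']]]] := Fe Z.
  have iP k : exists f : hom (W k) Z', fmap F f = t' \om i k by exact: Ff.
  have pP k : exists f : hom Z' (W k), fmap F f = p k \om t by exact: Ff.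
  exists Z', (fun k => sval (cid (iP k))), (fun k => sval (cid (pP k))).
  have Ei k : fmap F (sval (cid (iP k))) = t' \om i k := svalP (cid (iP k)).
  have Ep k : fmap F (sval (cid (pP k))) = p k \om t := svalP (cid (pP k)).
  split=> [k|k l kl|]; apply: (faithful_inj Fi).
  + rewrite fmap_comp Ei Ep fmap_id -compA [t \om _]compA tt' comp1m.
    exact: pi1.
  + rewrite fmap_comp Ei Ep raddf0 -compA [t \om _]compA tt' comp1m.
    exact: pi0.
  + rewrite raddf_sum fmap_id -t't -[X in t' \om X]comp1m -ip.
    rewrite comp_suml comp_sumr; apply: eq_bigr => k _.
    by rewrite /= fmap_comp Ei Ep !compA.
- move=> X Y f; have [A [k ker_k]] := kerD _ _ (fmap F f).
  have [A' [t tI]] := Fe A; have [k' Fk'] := Ff (k \om t).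
  by exists A', k'; apply: reflect_kernel; rewrite Fk'; apply: kernel_iso_src.
- move=> X Y f; have [B [c cok_c]] := cokD _ _ (fmap F f).
  have [B' /isomorphic_sym[t tI]] := Fe B; have [c' Fc'] := Ff (t \om c).
  by exists B', c'; apply: reflect_cokernel; rewrite Fc'; apply: cokernel_iso_tgt.
- move=> X Y f /preserve_mono /mkD [Z [g ker_g]].
  have [Z' /isomorphic_sym[t tI]] := Fe Z; have [g' Fg'] := Ff (t \om g).
  by exists Z', g'; apply: reflect_kernel; rewrite Fg'; apply: kernel_iso_tgt.
- move=> X Y f /preserve_epi /ecD [Z [g cok_g]].
  have [Z' [t tI]] := Fe Z; have [g' Fg'] := Ff (g \om t).
  by exists Z', g'; apply: reflect_cokernel; rewrite Fg'; apply: cokernel_iso_src.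
Qed.

End AbelianTransport.

(** * Triangulated categories *)

Section Triangles.
Variables (K : fieldType) (C : triCat K).

Lemma shift_faithful : faithful (shift C).
Proof. exact: equivalence_faithful (shift_equiv C). Qed.

Lemma shift_inj (X Y : C) (f g : hom X Y) :
  fmap (shift C) f = fmap (shift C) g -> f = g.
Proof. exact: faithful_inj shift_faithful _ _ _ _. Qed.

Lemma shift_full : full (shift C).
Proof. exact: equivalence_full (shift_equiv C). Qed.

Lemma shift_ess_surj : ess_surj (shift C).
Proof. exact: equivalence_ess_surj (shift_equiv C). Qed.

Lemma is_iso_id (X : C) : is_iso (idm X).
Proof. by exists (idm X); rewrite comp1m. Qed.

Lemma zero_object : exists O : C, is_zero O.
Proof.
have W : 'I_0 -> C by case.
by have [O [i [p [_ _ s]]]] := tadd W; exists O; rewrite /is_zero -s big_ord0.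
Qed.

Lemma zero_shift (X : C) : is_zero X -> is_zero (X[+1]).
Proof. by move=> X0; rewrite /is_zero -fmap_id X0 raddf0. Qed.

Section OneTriangle.
Variables (X Y Z : C) (f : hom X Y) (g : hom Y Z) (h : hom Z (X[+1])).
Hypothesis fgh : dist f g h.

Lemma dist_comp_gf : g \om f = 0.
Proof.
have [O O0] := zero_object.
have [|c [cg _]] := dist_mor (a := idm X) (b := f) (dist_id X O0) fgh.
  by [].
by rewrite -cg compm0.
Qed.

Lemma weak_ker_f (T : C) (k : hom T Y) : g \om k = 0 -> exists l, k = f \om l.
Proof.
move=> gk0; have [O O0] := zero_object.
have tT : dist (0 : hom T O) (0 : hom O (T[+1])) (- fmap (shift C) (idm T)).
  exact: (proj1 (dist_rot _ _ _) (dist_id T O0)).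
have tf : dist g h (- fmap (shift C) f) := proj1 (dist_rot _ _ _) fgh.
have [|c [_ ck]] := dist_mor (a := k) (b := 0) tT tf; first by rewrite comp0m gk0.
have [l Fl] := shift_full c; exists l; apply: shift_inj.
rewrite fmap_comp Fl; apply: oppr_inj.
by rewrite -compNl -ck fmap_id compNr compm1.
Qed.

Lemma weak_cok_f (T : C) (k : hom Y T) : k \om f = 0 -> exists l, k = l \om g.
Proof.
move=> kf0; have [O O0] := zero_object.
have tT : dist (0 : hom O T) (idm T) (0 : hom T (O[+1])).
  apply: (proj2 (dist_rot _ _ _)); rewrite raddf0 oppr0.
  exact: dist_id (zero_shift O0).
have [|c [ck _]] := dist_mor (a := 0) (b := k) fgh tT; first by rewrite comp0m.
by exists c; rewrite ck comp1m.
Qed.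

End OneTriangle.

Section OneTriangleRotated.
Variables (X Y Z : C) (f : hom X Y) (g : hom Y Z) (h : hom Z (X[+1])).
Hypothesis fgh : dist f g h.

Lemma dist_rot1 : dist g h (- fmap (shift C) f).
Proof. exact: (proj1 (dist_rot _ _ _) fgh). Qed.

Lemma dist_rot2 : dist h (- fmap (shift C) f) (- fmap (shift C) g).
Proof. exact: (proj1 (dist_rot _ _ _) dist_rot1). Qed.

Lemma dist_comp_hg : h \om g = 0.
Proof. exact: dist_comp_gf dist_rot1. Qed.

Lemma dist_comp_fh : fmap (shift C) f \om h = 0.
Proof. by apply: oppr_inj; rewrite -compNl oppr0; apply: dist_comp_gf dist_rot2. Qed.

Lemma weak_ker_g (T : C) (k : hom T Z) : h \om k = 0 -> exists l, k = g \om l.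
Proof. exact: weak_ker_f dist_rot1 _ _. Qed.

Lemma weak_cok_g (T : C) (k : hom Z T) : k \om g = 0 -> exists l, k = l \om h.
Proof. exact: weak_cok_f dist_rot1 _ _. Qed.

Lemma weak_ker_h (T : C) (k : hom T (X[+1])) :
  fmap (shift C) f \om k = 0 -> exists l, k = h \om l.
Proof. by move=> k0; apply: (weak_ker_f dist_rot2); rewrite compNl k0 oppr0. Qed.

Lemma weak_cok_h (T : C) (k : hom (X[+1]) T) :
  k \om h = 0 -> exists l, k = l \om fmap (shift C) f.
Proof.
move=> /(weak_cok_f dist_rot2) [l ->].
by exists (- l); rewrite compNl compNr.
Qed.

(** The shift is only an equivalence, so the inverse rotation of a triangle
exists after replacing Z by an isomorphic P[1]. *)
Lemma dist_unrot : exists (P : C) (k : hom P X) (l : hom Y (P[+1])),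
  dist k f l /\ isomorphic (P[+1]) Z.
Proof.
have [P [t [t' [t't tt']]]] := shift_ess_surj Z.
have [k Fk] := shift_full (- (h \om t)).
exists P, k, (t' \om g); split; last by exists t, t'.
apply: (proj2 (dist_rot _ _ _)).
apply: (dist_iso (is_iso_id X) (is_iso_id Y) (c := t')) fgh.
- by exists t.
- by rewrite compm1 comp1m.
- by rewrite compm1.
- by rewrite fmap_id comp1m Fk opprK -compA tt' compm1.
Qed.

End OneTriangleRotated.

Lemma dist_iso3 (X Y Z Z' : C) (f : hom X Y) (g : hom Y Z) (h : hom Z (X[+1]))
    (t : hom Z Z') (t' : hom Z' Z) :
  t' \om t = idm Z -> t \om t' = idm Z' -> dist f g h ->
  dist f (t \om g) (h \om t').
Proof.
move=> t't tt'; apply: (dist_iso (is_iso_id X) (is_iso_id Y) (c := t)).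
- by exists t'.
- by rewrite comp1m compm1.
- by rewrite compm1.
- by rewrite fmap_id comp1m -compA t't compm1.
Qed.

(** In the triangle X -> Z -> Y -> X[1] on a split monomorphism the third
morphism is zero, which splits Z -> Y and provides the complement. *)
Lemma split_mono_summand (X Z : C) (s : hom X Z) (r : hom Z X) :
  r \om s = idm X -> summand X Z.
Proof.
move=> rs; have [Y [p [h sph]]] := dist_ex s.
have h0 : h = 0.
  by rewrite -[h]comp1m -fmap_id -rs fmap_comp -compA (dist_comp_fh sph) compm0.
have [t pt] : exists t, idm Z - s \om r = t \om p.
  by apply: (weak_cok_f sph); rewrite compBl comp1m -compA rs compm1 subrr.
have ptp : (p \om t - idm Y) \om p = 0.
  rewrite compBl -compA -pt compBr compm1 comp1m compA (dist_comp_gf sph) comp0m.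
  by rewrite subr0 subrr.
have /subr0_eq pt1 : p \om t - idm Y = 0.
  by have [l ->] := weak_cok_g sph ptp; rewrite h0 compm0.
have rt0 : r \om t = 0.
  have [|l ->] := @weak_cok_g _ _ _ _ _ _ sph _ (r \om t).
    by rewrite -compA -pt compBr compm1 compA rs comp1m subrr.
  by rewrite h0 compm0.
apply: (summand_biprod (j := t) (q := p) rs) => //; last by rewrite -pt addrC subrK.
exact: dist_comp_gf sph.
Qed.

End Triangles.

(** * Quotients by an ideal *)

Section QuotientFunctor.
Variables (K : fieldType) (C : linCat K) (J : ideal C).

Lemma qpi_linear (X Y : C) : linear (@qpi K C J X Y).
Proof. by move=> a f g; rewrite qpi_lin. Qed.

HB.instance Definition _ (X Y : C) :=
  GRing.isLinear.Build K (hom X Y) (qhom J X Y) *:%R (@qpi K C J X Y)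
    (@qpi_linear X Y).

Lemma qpi_compE (X Y Z : C) (g : hom Y Z) (f : hom X Y) :
  qpi J (g \om f) = @comp K (quotcat J) X Y Z (qpi J g) (qpi J f).
Proof. by rewrite /= qpi_comp. Qed.

Definition quotF : linFunctor C (quotcat J) :=
  @LinFunctor K C (quotcat J) id
    (fun X Y => (@qpi K C J X Y : {linear hom X Y -> qhom J X Y}))
    (fun _ => erefl) qpi_compE.

Arguments quotF : simpl never.

Lemma quotF_full : full quotF.
Proof. by move=> X Y u; exists (repr (u : qhom J X Y)); apply: qreprK. Qed.

Lemma quotF_eq0 (X Y : C) (f : hom X Y) : fmap quotF f = 0 <-> imem J f.
Proof.
have e0 : fmap quotF (0 : hom X Y) = 0 by rewrite raddf0.
split=> [f0|Jf]; first by rewrite -[f]subr0; apply: qpi_eqP; rewrite [LHS]f0 -e0.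
by rewrite -e0; apply: qpi_eq; rewrite subr0.
Qed.

Variables (D : linCat K) (F : linFunctor C D).
Hypothesis FJ : forall (X Y : C) (f : hom X Y), imem J f -> fmap F f = 0.

Definition quot_lift_map (X Y : C) (u : @hom K (quotcat J) X Y) :
  hom (F X) (F Y) := fmap F (repr (u : qhom J X Y)).

Lemma quot_lift_pi (X Y : C) (f : hom X Y) :
  quot_lift_map (fmap quotF f) = fmap F f.
Proof. by apply/subr0_eq; rewrite -raddfB; apply/FJ/qrepr. Qed.

Lemma quot_lift_linear (X Y : C) : linear (@quot_lift_map X Y).
Proof.
move=> a u v; have [f <-] := quotF_full u; have [g <-] := quotF_full v.
by rewrite -linearP !quot_lift_pi linearP.
Qed.

HB.instance Definition _ (X Y : C) :=
  GRing.isLinear.Build K (@hom K (quotcat J) X Y) (hom (F X) (F Y)) *:%R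
    (@quot_lift_map X Y) (@quot_lift_linear X Y).

Lemma quot_lift_id (X : C) : quot_lift_map (@idm K (quotcat J) X) = idm (F X).
Proof. by rewrite -(fmap_id quotF) quot_lift_pi fmap_id. Qed.

Lemma quot_lift_comp (X Y Z : C) (v : @hom K (quotcat J) Y Z)
    (u : @hom K (quotcat J) X Y) :
  quot_lift_map (v \om u) = quot_lift_map v \om quot_lift_map u.
Proof.
have [f <-] := quotF_full u; have [g <-] := quotF_full v.
by rewrite -fmap_comp !quot_lift_pi fmap_comp.
Qed.

Definition quot_lift : linFunctor (quotcat J) D :=
  @LinFunctor K (quotcat J) D F (fun X Y => (@quot_lift_map X Y : {linear _ -> _}))
    quot_lift_id quot_lift_comp.

Lemma quot_lift_faithful :
  (forall (X Y : C) (f : hom X Y), fmap F f = 0 -> imem J f) -> faithful quot_lift.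
Proof.
move=> FJ' X Y u; have [f <-] := quotF_full u.
by rewrite [fmap _ _]quot_lift_pi => /FJ' /quotF_eq0.
Qed.

Lemma quot_lift_full : full F -> full quot_lift.
Proof.
move=> Ff X Y h; have [f Ef] := Ff X Y h.
by exists (fmap quotF f); rewrite -Ef [LHS]quot_lift_pi.
Qed.

Lemma quot_lift_ess_surj : ess_surj F -> ess_surj quot_lift.
Proof. by []. Qed.

End QuotientFunctor.

(** * Cotorsion pairs in a 2-Calabi-Yau category *)

Lemma scalar_ext (K : fieldType) (V : lmodType K) (f g : {scalar V}) :
  f =1 g -> f = g.
Proof.
move: f g => [f cf] [g cg] /= /funext fg; move: cf cg; rewrite fg.
move=> [[f1] [f2]] [[g1] [g2]].
by rewrite (Prop_irrelevance f1 g1) (Prop_irrelevance f2 g2).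
Qed.

(** Hom(B, A[1]) is dual to Hom(A[1], B[2]), that is to Ext^1(A, B). *)
Lemma ext1_sym (K : fieldType) (C : triCat K) (CY : calabi_yau2 C) (A B : C) :
  Ext1_zero A B -> Ext1_zero B A.
Proof.
move=> AB f; have [phi [phiD phi_bij _]] := CY.
apply: (bij_inj (phi_bij _ _)); apply: scalar_ext => h.
have [k <-] := shift_full h; rewrite (AB k) raddf0.
by rewrite [LHS]raddf0 [RHS]raddf0.
Qed.

Section Cotorsion.
Variables (K : fieldType) (C : triCat K) (CY : calabi_yau2 C).
Variables (X Y : subcat C) (XY : cotorsion_pair X Y).

Local Notation sh := (fmap (shift C)).

Lemma orthXY A B : X A -> Y B -> Ext1_zero A B.
Proof. by case: XY => o _; apply: o. Qed.

Lemma orthYX A B : Y B -> X A -> Ext1_zero B A.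
Proof. by move=> YB XA; apply: (ext1_sym CY); apply: orthXY. Qed.

Lemma cotorsion_triangle (M : C) : exists (A B : C)
    (f : hom A M) (g : hom M (B[+1])) (h : hom (B[+1]) (A[+1])),
  [/\ X A, Y B & dist f g h].
Proof.
have [A [B' [f [g [h [XA [B YB [t [t' [t't tt']]]] fgh]]]]]] := proj2 XY M.
by exists A, B, f, (t \om g), (h \om t'); split=> //; apply: dist_iso3.
Qed.

(** If Ext^1(A, Y) = 0, the cotorsion triangle of A has zero second morphism, so
A is a direct summand of its X-part. *)
Lemma left_orthogonal (A : C) : (forall B, Y B -> Ext1_zero A B) -> X A.
Proof.
move=> AY; have [A0 [B [f [g [h [XA0 YB fgh]]]]]] := cotorsion_triangle A.
have [|l fl] := @weak_ker_f _ _ _ _ _ _ _ _ fgh _ (idm A).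
  by rewrite compm1; apply: AY.
have [_ Xs] := smemP X; apply: Xs XA0.
by apply: (split_mono_summand (s := l) (r := f)).
Qed.

Lemma extension_closed (A B D : C) (f : hom A B) (g : hom B D)
    (h : hom D (A[+1])) : dist f g h -> X A -> X D -> X B.
Proof.
move=> fgh XA XD; apply: left_orthogonal => E YE k.
have [|l ->] := weak_cok_f fgh (k := k); first exact: orthXY.
by rewrite (orthXY XD YE l) comp0m.
Qed.

Definition cosyzygy_tri (A J B : C) (i : hom A J) (p : hom J B)
  (d : hom B (A[+1])) := [/\ dist i p d, X A, core X Y J & X B].

Lemma coreX J : core X Y J -> X J. Proof. by case. Qed.
Lemma coreY J : core X Y J -> Y J. Proof. by case. Qed.

(** The cotorsion triangle B -> A[1] -> D[1] of A[1] rotates to A -> D -> B, and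
D, being an extension of objects of X, lies in the core. *)
Lemma cosyzygy_ex (A : C) : X A -> exists J B i p d, @cosyzygy_tri A J B i p d.
Proof.
move=> XA.
have [B [D [f [g [h [XB YD fgh]]]]]] := cotorsion_triangle (A[+1]).
have [a Ea] := shift_full g; have [b Eb] := shift_full h.
have abf : dist (- a) (- b) f.
  apply: (proj2 (dist_rot _ _ _)); apply: (proj2 (dist_rot _ _ _)).
  by rewrite !raddfN /= !opprK Ea Eb.
by exists D, B, (- a), (- b), f; split=> //; split=> //; apply: extension_closed abf _ _.
Qed.

Local Notation Q := (quotcat (factor_ideal (@tadd K C) (core X Y))).
Local Notation pi := (fmap (quotF (factor_ideal (@tadd K C) (core X Y)))).

Lemma pi_eq0 (A B : C) (f : hom A B) : pi f = 0 <-> factors (core X Y) f.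
Proof. exact: quotF_eq0. Qed.

(** * Suspension modulo the core *)

Section Desuspension.
Variables (A J B : C) (i : hom A J) (p : hom J B) (d : hom B (A[+1])).
Variables (A' J' B' : C) (i' : hom A' J') (p' : hom J' B') (d' : hom B' (A'[+1])).
Hypotheses (t : cosyzygy_tri i p d) (t' : cosyzygy_tri i' p' d').

Lemma suspend (f : hom A A') : exists f' : hom B B', d' \om f' = sh f \om d.
Proof.
have [ipd XA JJ XB] := t; have [ipd' XA' JJ' XB'] := t'.
have [|l ->] := weak_ker_h ipd' (k := sh f \om d); last by exists l.
exact: orthXY XB (coreY JJ') _.
Qed.

Lemma desuspend (f' : hom B B') : exists f : hom A A', d' \om f' = sh f \om d.
Proof.
have [ipd XA JJ XB] := t; have [ipd' XA' JJ' XB'] := t'.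
have [|l ->] := weak_cok_g ipd (k := d' \om f').
  exact: orthYX (coreY JJ) XA' _.
by have [f <-] := shift_full l; exists f.
Qed.

(** If f factors through L in the core, then d' \om f' factors through B -> L[1],
which is zero; so f' lifts to J'. *)
Lemma suspend_eq0 (f : hom A A') (f' : hom B B') :
  d' \om f' = sh f \om d -> pi f = 0 -> pi f' = 0.
Proof.
have [ipd XA JJ XB] := t; have [ipd' XA' JJ' XB'] := t'.
move=> ff' /pi_eq0 [L [v [u [JL fvu]]]]; apply/pi_eq0.
have [|l ->] := weak_ker_g ipd' (k := f'); last by exists J', p', l.
rewrite ff' fvu fmap_comp -compA.
by rewrite [X in _ \om X](orthXY XB (coreY JL)) compm0.
Qed.

Lemma weak_desuspend (T : C) (k : hom A T) : sh k \om d = 0 ->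
  exists l, k = l \om i.
Proof.
have [ipd XA JJ XB] := t.
move=> /(weak_cok_h ipd) [l]; have [l' <-] := shift_full l.
by rewrite -fmap_comp => /shift_inj ->; exists l'.
Qed.

Lemma desuspend_eq0 (f : hom A A') (f' : hom B B') :
  d' \om f' = sh f \om d -> pi f' = 0 -> pi f = 0.
Proof.
have [ipd XA JJ XB] := t; have [ipd' XA' JJ' XB'] := t'.
move=> ff' /pi_eq0 [L [v [u [JL fvu]]]]; apply/pi_eq0.
have [|l ->] := weak_desuspend (k := f); last by exists J, l, i.
by rewrite -ff' fvu compA (orthYX (coreY JL) XA' (d' \om v)) comp0m.
Qed.

End Desuspension.

Lemma suspend_pi_inj (A J B A' J' B' : C) (i : hom A J) (p : hom J B)
    (d : hom B (A[+1])) (i' : hom A' J') (p' : hom J' B') (d' : hom B' (A'[+1]))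
    (f g : hom A A') (f' g' : hom B B') :
  cosyzygy_tri i p d -> cosyzygy_tri i' p' d' ->
  d' \om f' = sh f \om d -> d' \om g' = sh g \om d -> pi f = pi g -> pi f' = pi g'.
Proof.
move=> t t' ff' gg' fg; apply/subr0_eq; rewrite -fmapB.
apply: (suspend_eq0 t t' (f := f - g)); last by rewrite fmapB fg subrr.
by rewrite compBr fmapB compBl ff' gg'.
Qed.

Lemma desuspend_pi_inj (A J B A' J' B' : C) (i : hom A J) (p : hom J B)
    (d : hom B (A[+1])) (i' : hom A' J') (p' : hom J' B') (d' : hom B' (A'[+1]))
    (f g : hom A A') (f' g' : hom B B') :
  cosyzygy_tri i p d -> cosyzygy_tri i' p' d' ->
  d' \om f' = sh f \om d -> d' \om g' = sh g \om d -> pi f' = pi g' -> pi f = pi g.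
Proof.
move=> t t' ff' gg' fg; apply/subr0_eq; rewrite -fmapB.
apply: (desuspend_eq0 t t' (f' := f' - g')); last by rewrite fmapB fg subrr.
by rewrite compBr fmapB compBl ff' gg'.
Qed.

Definition cosyzygy A B := exists J i p d, @cosyzygy_tri A J B i p d.

(** Equivalently, B is a direct summand of the sum of M and a core object. *)
Definition core_retract (B M : C) :=
  exists (s : hom B M) (r : hom M B), pi (r \om s) = pi (idm B).

Lemma core_retract_refl B : core_retract B B.
Proof. by exists (idm B), (idm B); rewrite comp1m. Qed.

Lemma core_retract_trans A B D :
  core_retract A B -> core_retract B D -> core_retract A D.
Proof.
move=> [s [r rs]] [s' [r' rs']]; exists (s' \om s), (r \om r').
rewrite !fmap_comp -compA [pi r' \om _]compA -[pi r' \om _]fmap_comp rs'.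
by rewrite fmap_id comp1m -fmap_comp rs.
Qed.

Lemma retract_core_retract B M (s : hom B M) (r : hom M B) :
  r \om s = idm B -> core_retract B M.
Proof. by move=> rs; exists s, r; rewrite rs. Qed.

Lemma isomorphic_core_retract A B : isomorphic A B -> core_retract A B.
Proof. by move=> [f [g [gf _]]]; apply: retract_core_retract gf. Qed.

Lemma core_retract_mem B M : X M -> core_retract B M -> X B.
Proof.
move=> XM [s [r rs]]; apply: left_orthogonal => D YD g.
have /pi_eq0 [L [v [u [JL vu]]]] : pi (idm B - r \om s) = 0.
  by rewrite fmapB rs subrr.
rewrite -[g]compm1 -[idm B](subrK (r \om s)) vu compDr !compA.
rewrite [g \om r](orthXY XM YD) [g \om v](orthXY (coreX JL) YD).
by rewrite !comp0m addr0.
Qed.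

Definition suspended (P : C -> Prop) (B : C) :=
  exists A M, [/\ P A, cosyzygy A M & core_retract B M].

(** The direct summands, modulo the core, of n-fold suspensions of objects of X. *)
Definition iter_susp n : C -> Prop := iter n suspended X.

Lemma suspended_sub P P' : (forall B, P B -> P' B) ->
  forall B, suspended P B -> suspended P' B.
Proof. by move=> PP' B [A [M [/PP' PA AM BM]]]; exists A, M. Qed.

Lemma suspended_mem P B : suspended P B -> X B.
Proof. by move=> [A [M [_ [J [i [p [d [_ _ _ XM]]]]] /core_retract_mem]]]; apply. Qed.

Lemma iter_susp_mem n B : iter_susp n B -> X B.
Proof. by case: n => [|n] //; apply: suspended_mem. Qed.

Lemma iter_susp_decr n B : iter_susp n.+1 B -> iter_susp n B.
Proof.
elim: n B => [|n IH] B; first exact: iter_susp_mem.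
exact: suspended_sub IH B.
Qed.

Lemma iter_susp_retract n B M : iter_susp n M -> core_retract B M -> iter_susp n B.
Proof.
case: n => [|n] /=; first exact: core_retract_mem.
move=> [A [M' [PA AM' MM']]] BM; exists A, M'; split=> //.
exact: core_retract_trans BM MM'.
Qed.

(** Suspending the direct sum A0 of the A k, its injections and its projections
gives M0 the structure of a direct sum of the M k modulo the core; no direct sum
of triangles has to be formed. *)
Lemma iter_susp_dsum n m (W : 'I_m -> C) Z : is_dsum W Z ->
  (forall k, iter_susp n (W k)) -> iter_susp n Z.
Proof.
elim: n m W Z => [|n IH] m W Z WZ.
  by have [Xd _] := smemP X; apply: Xd WZ.
move=> /(_ _)/cid-/all_sig[A] /(_ _)/cid-/all_sig[M] WAM.
have [A0 AA0] := tadd A.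
have PA0 : iter_susp n A0 by apply: IH AA0 _ => k; have [] := WAM k.
have [J [M0 [i [p [d t0]]]]] := cosyzygy_ex (iter_susp_mem PA0).
exists A0, M0; split=> //; first by exists J, i, p, d.
have [inA [prA [piA1 piA0 _]]] := AA0.
have [inW [prW [piW1 piW0 sW]]] := WZ.
have tr k : exists J' i' p' d', @cosyzygy_tri (A k) J' (M k) i' p' d'.
  by have [] := WAM k.
move: tr => /(_ _)/cid-/all_sig[J'] /(_ _)/cid-/all_sig[i'].
move=> /(_ _)/cid-/all_sig[p'] /(_ _)/cid-/all_sig[d'] t'.
have inS k : exists f : hom (M k) M0, d \om f = sh (inA k) \om d' k.
  exact: suspend (t' k) t0 _.
have prS k : exists f : hom M0 (M k), d' k \om f = sh (prA k) \om d.
  exact: suspend t0 (t' k) _.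
move: inS prS => /(_ _)/cid-/all_sig[inM inMP] /(_ _)/cid-/all_sig[prM prMP].
have piM k l : d' l \om (prM l \om inM k) = sh (prA l \om inA k) \om d' k.
  by rewrite compA prMP -compA inMP compA -fmap_comp.
have piM1 k : pi (prM k \om inM k) = pi (idm _).
  apply: (suspend_pi_inj (t' k) (t' k) (piM k k)); last by rewrite piA1.
  by rewrite fmap_id comp1m compm1.
have piM0 k l : k != l -> pi (prM l \om inM k) = 0.
  by move=> kl; apply: (suspend_eq0 (t' k) (t' l) (piM k l)); rewrite piA0 // fmap0.
have rt k : core_retract (W k) (M k) by have [] := WAM k.
move: rt => /(_ _)/cid-/all_sig[s] /(_ _)/cid-/all_sig[r] rs.
exists (\sum_k inM k \om s k \om prW k), (\sum_k inW k \om r k \om prM k).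
rewrite comp_suml -sW !fmap_sum; apply: eq_bigr => k _.
rewrite comp_sumr fmap_sum (bigD1 k) //= big1 ?addr0 => [|l lk].
  transitivity (pi (inW k) \om pi (r k) \om pi (prM k \om inM k) \om pi (s k)
                \om pi (prW k)); first by rewrite -!fmap_comp !compA.
  rewrite piM1 fmap_id compm1 -[_ \om pi (s k)]compA -[pi (r k) \om _]fmap_comp.
  by rewrite rs fmap_id compm1 -fmap_comp.
transitivity (pi (inW k) \om pi (r k) \om pi (prM k \om inM l) \om pi (s l)
              \om pi (prW l)); first by rewrite -!fmap_comp !compA.
by rewrite piM0 // compm0 !comp0m.
Qed.

(** Suspend B once: it becomes a retract modulo the core of the suspension of
some A, and desuspending the two structure morphisms makes B a retract of A. *)
Lemma iter_susp_descend n :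
  (forall B, iter_susp n.+1 B -> iter_susp n.+2 B) ->
  forall B, iter_susp n B -> iter_susp n.+1 B.
Proof.
move=> nn B nB; have [J [M [i [p [d t]]]]] := cosyzygy_ex (iter_susp_mem nB).
have /nn [A [M' [nA [J' [i' [p' [d' t']]]] [s [r rs]]]]] : iter_susp n.+1 M.
  exists B, M; split=> //; first by exists J, i, p, d.
  exact: core_retract_refl.
apply: (@iter_susp_retract n.+1 B A nA).
have [s0 ss0] := desuspend t t' s; have [r0 rr0] := desuspend t' t r.
exists s0, r0; apply: (desuspend_pi_inj t t (f' := r \om s) (g' := idm M)) => //.
  by rewrite compA rr0 -compA ss0 compA -fmap_comp.
by rewrite compm1 fmap_id comp1m.
Qed.

(** * Finiteness *)

Lemma local_end_indecomposable (Z : C) : local_end Z -> indecomposable Z.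
Proof.
move=> [Z0 loc]; split=> // W [i [p [pi1 pi0 s]]].
have kill (k l : 'I_2) : k != l -> is_iso (i k \om p k) -> is_zero (W l).
  move=> kl [u [_ fu]].
  have pl0 : p l = 0.
    by rewrite -[p l]compm1 -fu !compA pi0 // !comp0m.
  by rewrite /is_zero -(pi1 l) pl0 comp0m.
pose k0 : 'I_2 := ord0; pose k1 : 'I_2 := lift ord0 ord0.
have [iso|iso] := loc (i k0 \om p k0).
  by exists k1; apply: kill iso.
exists k0; apply: (@kill k1) => //.
have <- : idm Z - i k0 \om p k0 = i k1 \om p k1; last by [].
by rewrite -s big_ord_recl big_ord1 addrC addKr.
Qed.

Lemma antitone_stable (T : finType) (S : nat -> {set T}) :
  (forall n, S n.+1 \subset S n) -> exists n, S n.+1 = S n.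
Proof.
move=> S_decr; suff: forall m n, (#|S n| <= m)%N -> exists n, S n.+1 = S n.
  by move=> /(_ _ 0%N (leqnn _)).
elim=> [|m IH] n; last first.
  move=> Sn; have [E|NE] := eqVneq (S n.+1) (S n); first by exists n.
  apply: (IH n.+1); rewrite -ltnS; apply: leq_trans Sn.
  by apply: proper_card; rewrite properEneq NE S_decr.
rewrite leqn0 cards_eq0 => /eqP S0; exists n; rewrite S0; apply/eqP.
by rewrite -subset0 -S0.
Qed.

Section Finiteness.
Hypotheses (CKS : krull_schmidt C) (Cfinite : finite_cat C).

(** By the Krull-Schmidt property an iterate is determined by the finitely many
indecomposables that it contains, and a decreasing sequence of subsets of a
finite set becomes stationary. *)
Lemma iter_susp_stable : exists n, forall B, iter_susp n B -> iter_susp n.+1 B.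
Proof.
have [N [V VP]] := Cfinite.
pose S n : {set 'I_N} := [set j | `[< iter_susp n (V j) >]].
have [n|n Sn] := @antitone_stable _ S.
  apply/subsetP => j; rewrite !inE => /asboolP VS; apply/asboolP.
  exact: iter_susp_decr.
exists n => B nB; have [m [W [WB Wloc]]] := CKS B.
apply: (iter_susp_dsum WB) => k.
have [j VW] := VP _ (local_end_indecomposable (Wloc k)).
apply: (@iter_susp_retract n.+1 _ (V j)); last first.
  exact/isomorphic_core_retract/isomorphic_sym.
have: j \in S n.
  rewrite inE; apply/asboolP; apply: iter_susp_retract nB _.
  apply: core_retract_trans (isomorphic_core_retract VW) _.
  by have [i [p [pi1 _ _]]] := WB; apply: retract_core_retract (pi1 k).
by rewrite -Sn inE => /asboolP.
Qed.

(** The suspension is dense on X up to summands: stationarity at some n descends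
to n = 0. *)
Lemma all_suspended B : X B -> suspended X B.
Proof.
have [n] := iter_susp_stable.
elim: n => [|n IH] nB; first exact: nB.
by apply: IH; apply: iter_susp_descend.
Qed.

Section Core.
Hypothesis Cfin : hom_finite C.
Variable I : C.
Hypothesis coreI : forall M : C, core X Y M <-> add_closure I M.

Lemma core_powers n Z : is_dsum (fun _ : 'I_n => I) Z -> core X Y Z.
Proof.
move=> IZ; apply/coreI; exists n, Z; split=> //.
by apply: (split_mono_summand (s := idm Z) (r := idm Z)); rewrite comp1m.
Qed.

Lemma core_retract_powers J : core X Y J ->
  exists n (a : 'I_n -> hom I J) (b : 'I_n -> hom J I), \sum_k a k \om b k = idm J.
Proof.
move=> /coreI [n [Z [[i [p [_ _ ip]]] [m [W [[j [q [qj _ _]]] [k Wk]]]]]]].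
move: j q qj; rewrite -Wk => j q qj.
exists n, (fun l => q k \om i l), (fun l => p l \om j k).
rewrite -[RHS](qj k) -[q k in RHS]compm1 -ip comp_sumr comp_suml.
by apply: eq_bigr => l _; rewrite !compA.
Qed.

Lemma core_hom_eq0 J T (g : hom J T) : core X Y J ->
  (forall u : hom I J, g \om u = 0) -> g = 0.
Proof.
move=> /core_retract_powers [n [a [b ab]]] g0.
by rewrite -[g]compm1 -ab comp_sumr big1 // => k _; rewrite compA g0 comp0m.
Qed.

(** The right approximation of B is built from a finite generating family of
Hom(I, B). *)
Lemma core_approx B : exists (J : C) (p : hom J B), core X Y J /\
  forall (J' : C) (u : hom J' B), core X Y J' -> exists v : hom J' J, u = p \om v.
Proof.
have [s sP] := Cfin I B; have [Z IZ] := tadd (fun _ : 'I_(size s) => I).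
have [i [q [qi1 qi0 _]]] := IZ.
exists Z, (\sum_(k < size s) s`_k \om q k); split; first exact: core_powers IZ.
move=> J' u /core_retract_powers [n [a [b ab]]].
have lift k : exists v, u \om a k = (\sum_(k < size s) s`_k \om q k) \om v.
  have [c ->] := sP (u \om a k); exists (\sum_l c l *: i l).
  rewrite comp_suml; apply: eq_bigr => l _; rewrite comp_sumr (bigD1 l) //=.
  rewrite big1 => [|m ml]; first by rewrite addr0 compZr -compA qi1 compm1.
  by rewrite compZr -compA qi0 ?compm0 ?scaler0.
move: lift => /(_ _)/cid-/all_sig[v vP].
exists (\sum_k v k \om b k); rewrite -[LHS]compm1 -ab !comp_sumr.
by apply: eq_bigr => k _; rewrite !compA -vP.
Qed.

(** The cone of a right core approximation of B is A'[1]; since B is a retract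
modulo the core of a suspension of some A in X, comparing the triangles makes A'
a retract of A modulo the core, whence Ext^1(A', Y) = 0. *)
Lemma syzygy_ex B : X B -> exists A J i p d, @cosyzygy_tri A J B i p d.
Proof.
move=> XB; have [A [M [XA [J1 [i1 [p1 [d1 t1]]]] [s [r rs]]]]] := all_suspended XB.
have [ipd1 _ JJ1 XM] := t1.
have [J [p [JJ pP]]] := core_approx B.
have [B1 [x [y pxy]]] := dist_ex p.
have [A' [i [d [ipd _]]]] := dist_unrot pxy.
exists A', J, i, p, d; split=> //; apply: left_orthogonal => D YD g.
have /pi_eq0 [L [v [u [JL vu]]]] : pi (r \om s - idm B) = 0.
  by rewrite fmapB rs subrr.
have [rho Erho] : exists rho : hom A A', d \om r = sh rho \om d1.
  have [|l ->] := weak_cok_g ipd1 (k := d \om r).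
    have [w rw] := pP _ (r \om p1) JJ1.
    by rewrite -compA rw compA (dist_comp_hg ipd) comp0m.
  by have [rho <-] := shift_full l; exists rho.
have [sig Esig] : exists sig : hom A' A, d1 \om s = sh sig \om d.
  have [|l ->] := weak_cok_g ipd (k := d1 \om s).
    exact: orthYX (coreY JJ) XA _.
  by have [sig <-] := shift_full l; exists sig.
have [l El] : exists l, idm A' - rho \om sig = l \om i.
  have [|l] := weak_cok_h ipd (k := sh (idm A' - rho \om sig)); last first.
    by have [l' <-] := shift_full l; rewrite -fmap_comp => /shift_inj; exists l'.
  have [w Ew] := pP _ v JL.
  rewrite fmapB fmap_id fmap_comp compBl comp1m -compA -Esig compA -Erho -compA.
  rewrite -[r \om s](subrK (idm B)) vu compDr compm1 Ew.
  by rewrite !compA (dist_comp_hg ipd) !comp0m add0r subrr.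
rewrite -[g]compm1 -[idm A'](subrK (rho \om sig)) El compDr !compA.
rewrite [g \om rho](orthXY XA YD) [g \om l](orthXY (coreX JJ) YD).
by rewrite !comp0m addr0.
Qed.

(** * The functor Hom(I, -[1]) on the heart *)

Lemma core_generator : core X Y I.
Proof.
apply: (@core_powers 1%N); exists (fun=> idm I), (fun=> idm I); split=> [k|k l|].
- by rewrite comp1m.
- by rewrite (ord1 k) (ord1 l) eqxx.
- by rewrite big_ord1 comp1m.
Qed.

Lemma heart_leftP M : star (unshiftP X) (core X Y) M <->
  exists J A (a : hom M J) (b : hom J A) (w : hom A (M[+1])),
    [/\ core X Y J, X A & dist a b w].
Proof.
split=> [[P [J [f [g [h [[A XA [t [t' [t't tt']]]] JJ fgh]]]]]]|].
  exists J, A, g, (t \om h), (- fmap (shift C) f \om t'); split=> //.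
  exact/dist_iso3/dist_rot1.
move=> [J [A [a [b [w [JJ XA abw]]]]]].
have [P [k [l [kal PA]]]] := dist_unrot abw.
by exists P, J, k, a, l; split=> //; exists A.
Qed.

Lemma heart_rightP M : star (core X Y) (shiftP Y) M <->
  exists J D (a : hom J M) (b : hom M (D[+1])) (w : hom (D[+1]) (J[+1])),
    [/\ core X Y J, Y D & dist a b w].
Proof.
split=> [[J [D' [f [g [h [JJ [D YD [t [t' [t't tt']]]] fgh]]]]]]|].
  by exists J, D, f, (t \om g), (h \om t'); split=> //; apply: dist_iso3.
move=> [J [D [a [b [w [JJ YD abw]]]]]].
exists J, (D[+1]), a, b, w; split=> //; exists D => //.
by exists (idm _); apply: is_iso_id.
Qed.

(** With A' -> J -> A -> A'[1] and J1 -> N -> D[1], g factors as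
A -> A'[1] -> J1[1] -> N[1], and the first two arrows compose to zero. *)
Lemma shifted_hom_eq0 A N (g : hom A (N[+1])) :
  X A -> star (core X Y) (shiftP Y) N ->
  (forall u : hom I A, g \om u = 0) -> g = 0.
Proof.
move=> XA /heart_rightP [J1 [D [f [q [e [JJ1 YD fq]]]]]] gI.
have [A' [J [i [p [d [ipd XA' JJ _]]]]]] := syzygy_ex XA.
have gp0 : g \om p = 0.
  by apply: (core_hom_eq0 JJ) => u; rewrite -compA gI.
have [g' ->] := weak_cok_g ipd gp0; have [k <-] := shift_full g'.
have [|l ->] := weak_ker_f fq (k := k); first exact: orthXY XA' YD _.
by rewrite fmap_comp -compA (orthXY XA (coreY JJ1) (_ \om d)) compm0.
Qed.

Lemma factors_shift_eq0 (M N : C) (f : hom M N) : factors (core X Y) f ->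
  forall x : hom I (M[+1]), sh f \om x = 0.
Proof.
move=> [J [v [u [JJ ->]]]] x.
by rewrite fmap_comp -compA (orthXY (coreX core_generator) (coreY JJ) (_ \om x)) compm0.
Qed.

Lemma heart_hom_faithful (M N : C) (f : hom M N) :
  star (unshiftP X) (core X Y) M -> star (core X Y) (shiftP Y) N ->
  (forall x : hom I (M[+1]), sh f \om x = 0) -> factors (core X Y) f.
Proof.
move=> /heart_leftP [J [A [a [b [w [JJ XA abw]]]]]] HN f0.
have : sh f \om w = 0.
  by apply: shifted_hom_eq0 XA HN _ => u; rewrite -compA f0.
move=> /(weak_cok_h abw) [l]; have [l' <-] := shift_full l.
by rewrite -fmap_comp => /shift_inj ->; exists J, l', a.
Qed.

Section EndLinearMap.
Variables (M N : C) (phi : hom I (M[+1]) -> hom I (N[+1])).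
Hypothesis phiD : {morph phi : x y / x + y}.
Hypothesis phiM : forall x (e : hom I I), phi (x \om e) = phi x \om e.

Let phi0 : phi 0 = 0.
Proof. by apply: (addrI (phi 0)); rewrite -phiD !addr0. Qed.

(** Yoneda's lemma for Hom(I, -) holds on the additive closure of I. *)
Lemma core_yoneda J (e : hom J (M[+1])) : core X Y J ->
  exists e' : hom J (N[+1]), forall u : hom I J, e' \om u = phi (e \om u).
Proof.
move=> /core_retract_powers [n [a [b ab]]].
exists (\sum_k phi (e \om a k) \om b k) => u.
rewrite -[u in RHS]comp1m -ab !comp_suml comp_sumr (big_morph _ phiD phi0).
by apply: eq_bigr => k _; rewrite -compA -phiM !compA.
Qed.

(** An End(I)-linear phi gives J -> N[1] on the approximation J -> A, which
descends to A -> N[1] and then extends to M[1] -> N[1]: both obstructions vanish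
on morphisms from I because phi is linear, hence are zero.  The result agrees
with phi since Hom(I, J) -> Hom(I, A) -> Hom(I, M[1]) are surjective. *)
Lemma heart_hom_full :
  star (unshiftP X) (core X Y) M -> star (core X Y) (shiftP Y) N ->
  exists f : hom M N, forall x, phi x = sh f \om x.
Proof.
move=> /heart_leftP [J0 [A [a [b [w [JJ0 XA abw]]]]]] HN.
have [A' [J [i [p [d [ipd XA' JJ _]]]]]] := syzygy_ex XA.
have lift (u : hom I A) : exists v, u = p \om v.
  apply: (weak_ker_g ipd).
  exact: orthYX (coreY core_generator) XA' _.
have [e eP] := core_yoneda (w \om p) JJ.
have ei0 : e \om i = 0.
  apply: (shifted_hom_eq0 XA' HN) => u.
  by rewrite -compA eP !compA -(compA w p) (dist_comp_gf ipd) compm0 comp0m phi0.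
have [g Eg] := weak_cok_f ipd ei0.
have gE (v : hom I J) : g \om (p \om v) = phi (w \om (p \om v)).
  by rewrite !compA -Eg eP.
have gb0 : g \om b = 0.
  apply: (core_hom_eq0 JJ0) => u; have [v Ev] := lift (b \om u).
  by rewrite -compA Ev gE -Ev compA (dist_comp_hg abw) comp0m phi0.
have [h Eh] := weak_cok_g abw gb0; have [f Ef] := shift_full h.
exists f => x.
have [|y ->] := weak_ker_h abw (k := x).
  exact: orthXY (coreX core_generator) (coreY JJ0) _.
by have [v ->] := lift y; rewrite -gE Eh Ef !compA.
Qed.

End EndLinearMap.

(** The cone M0[1] of a has the required Hom(I, -[1]) by rigidity, but only
M0 -> J1 -> J0 is of the shape needed in the heart.  Here X0 -> M0 -> Y0[1] is
the cotorsion triangle of M0 and M is its pushout along X0 -> JX, so that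
JX -> M -> Y0[1] gives the second shape.  The cone X1 of M0 -> M lies in X,
which leaves a triangle M -> Q' -> J0 -> M[1] with Q' in X; replacing Q' by its
core envelope JQ gives the first shape M -> JQ -> B with B in X. *)
Lemma heart_presentation (J1 J0 : C) (a : hom J1 J0) :
  core X Y J1 -> core X Y J0 ->
  exists (M : C) (c : hom J0 (M[+1])), [/\ heart_mem X Y M, c \om a = 0,
    forall x : hom I (M[+1]), exists u, x = c \om u
  & forall u : hom I J0, c \om u = 0 -> exists v, u = a \om v].
Proof.
move=> JJ1 JJ0.
have XI := coreX core_generator; have YI := coreY core_generator.
have [Q [g0 [h0 ag0]]] := dist_ex a.
have [M0 [k [c0 [kac _]]]] := dist_unrot ag0.
have [X0 [Y0 [f [g [h [XX0 YY0 fgh]]]]]] := cotorsion_triangle M0.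
have [eta Eeta] := shift_full h.
have etafg : dist (- eta) f g.
  by apply: (proj2 (dist_rot _ _ _)); rewrite fmapN opprK Eeta.
have [JX [X1 [i [p [d [ipd _ JJX XX1]]]]]] := cosyzygy_ex XX0.
have [M [h1 [h2 th]]] := dist_ex (i \om - eta).
(* M0 -> M -> X1 -> M0[1] *)
have [u [v [uv _ _ _ _]]] := dist_oct etafg ipd th.
have [P [q [v' [quv PX1]]]] := dist_unrot uv.
have [Q' [m1 [m2 tm]]] := dist_ex (k \om q).
(* M -> Q' -> J0 -> M[1], with P = X1[-1] and Q' an extension of X1 by J1 *)
have [u2 [v2 [uv2 _ _ _ _]]] := dist_oct quv kac tm.
have XP : X (P[+1]) by apply: subcat_iso XX1; apply: isomorphic_sym.
have XQ' : X Q' := extension_closed (dist_rot1 tm) (coreX JJ1) XP.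
have [JQ [XQ [i2 [p2 [d2 [ipd2 _ JJQ XXQ]]]]]] := cosyzygy_ex XQ'.
have [B [n1 [n2 tn]]] := dist_ex (i2 \om u2).
(* J0 -> B -> XQ exhibits B as an extension of objects of X *)
have [u3 [v3 [uv3 _ _ _ _]]] := dist_oct uv2 ipd2 tn.
have XB : X B := extension_closed uv3 (coreX JJ0) XXQ.
exists M, (sh u \om c0); split.
- split; first by apply/heart_leftP; exists JQ, B, (i2 \om u2), n1, n2.
  apply/heart_rightP; exists JX, Y0, h1, h2, (- sh (i \om - eta)).
  by split=> //; apply: dist_rot1.
- by rewrite -compA (dist_comp_hg kac) compm0.
- move=> x; have [|l ->] := weak_ker_g (dist_rot2 uv) (k := x).
    exact: orthYX YI XX1 _.
  have [|y Ey] := weak_ker_h kac (k := - l).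
    exact: orthXY XI (coreY JJ1) _.
  by exists y; rewrite -compA -Ey compNl compNr.
- move=> y; rewrite -compA => /(weak_ker_h uv) [l El].
  apply: (weak_ker_g kac); rewrite El -compA.
  by rewrite (orthYX YI XX0 (d \om l)) compm0.
Qed.

End Core.
End Finiteness.
End Cotorsion.

(** * Finitely generated modules *)

Section LinearMaps.
Variable R : pzRingType.

(** Carries the linearity proof in the term, from which the structure of linear
map is inferred. *)
Definition linear_of (M N : lmodType R) (f : M -> N) of linear f : M -> N := f.

HB.instance Definition _ (M N : lmodType R) (f : M -> N) (fL : linear f) :=
  GRing.isLinear.Build R M N *:%R (linear_of fL) fL.

Lemma factor_through_injective (M N T : lmodType R) (f : {linear M -> N})
    (g : {linear T -> N}) : injective f -> (forall t, exists m, f m = g t) ->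
  exists u : {linear T -> M}, forall t, f (u t) = g t.
Proof.
move=> fI /(_ _)/cid-/all_sig[u uP].
have uL : linear u by move=> a x y; apply: fI; rewrite linearP !uP linearP.
by exists (linear_of uL).
Qed.

Lemma factor_through_surjective (M N T : lmodType R) (f : {linear M -> N})
    (g : {linear M -> T}) : (forall n, exists m, f m = n) ->
  (forall m, f m = 0 -> g m = 0) ->
  exists u : {linear N -> T}, forall m, u (f m) = g m.
Proof.
move=> /(_ _)/cid-/all_sig[s sP] fg.
have gs m : g (s (f m)) = g m.
  by apply/subr0_eq; rewrite -raddfB; apply: fg; rewrite raddfB /= sP subrr.
have uL : linear (g \o s).
  by move=> a x y; rewrite /= -linearP -[RHS]gs linearP /= !sP.
by exists (linear_of uL).
Qed.

(** Bundled, so that the module structures on submodules and quotients can be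
inferred. *)
Record submodule (M : lmodType R) := Submodule {
  submodule_mem :> M -> Prop;
  submodule0 : submodule_mem 0;
  submoduleP : forall a x y, submodule_mem x -> submodule_mem y ->
    submodule_mem (a *: x + y)
}.

Section Subquotient.
Variables (M : lmodType R) (P : submodule M).

Definition submodule_pred : {pred M} := fun x => `[< P x >].

Lemma submodule_pred_closed : submod_closed submodule_pred.
Proof.
split; first exact/asboolP/submodule0.
by move=> a x y /asboolP Px /asboolP Py; apply/asboolP/submoduleP.
Qed.

HB.instance Definition _ := GRing.isSubmodClosed.Build R M submodule_pred
  submodule_pred_closed.

Record submodule_type := SubmoduleElt {
  submodule_val : M; _ : submodule_val \in submodule_pred }.

HB.instance Definition _ := [isSub for submodule_val].
HB.instance Definition _ := [Choice of submodule_type by <:].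
HB.instance Definition _ := [SubChoice_isSubLmodule of submodule_type by <:].

Lemma submodule_ex : exists (S : lmodType R) (v : {linear S -> M}),
  injective v /\ forall x, P x <-> exists s, v s = x.
Proof.
exists submodule_type, (val : {linear submodule_type -> M}).
split; first exact: val_inj.
move=> x; split=> [Px|[s <-]]; last exact/asboolP/(valP s).
have xP : x \in submodule_pred by apply/asboolP.
by exists (SubmoduleElt xP).
Qed.

Definition quotient_type := Quotient.quot submodule_pred.
HB.instance Definition _ := GRing.Zmodule.on quotient_type.

Definition quotient_pi (x : M) : quotient_type := \pi_quotient_type x.

Lemma quotient_pi_eq x y : quotient_pi x = quotient_pi y <-> P (x - y).
Proof.
split=> [/eqP|Pxy]; first by rewrite -Quotient.idealrBE => /asboolP.
by apply/eqP; rewrite -Quotient.idealrBE; apply/asboolP.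
Qed.

Lemma quotient_reprK (u : quotient_type) : quotient_pi (repr u) = u.
Proof. exact: reprK. Qed.

Definition quotient_scale (a : R) (u : quotient_type) : quotient_type :=
  quotient_pi (a *: repr u).

Lemma quotient_piD x y : quotient_pi (x + y) = quotient_pi x + quotient_pi y.
Proof. by rewrite /quotient_pi !piE. Qed.

Lemma quotient_piZ a x : quotient_scale a (quotient_pi x) = quotient_pi (a *: x).
Proof.
apply/quotient_pi_eq; rewrite -scalerBr -[_ *: _]addr0.
by apply: submoduleP (submodule0 P); apply/quotient_pi_eq/quotient_reprK.
Qed.

Lemma quotient_scaleA a b u :
  quotient_scale a (quotient_scale b u) = quotient_scale (a * b) u.
Proof. by rewrite -[u]quotient_reprK !quotient_piZ scalerA. Qed.

Lemma quotient_scale1 : left_id 1 quotient_scale.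
Proof. by move=> u; rewrite -[u]quotient_reprK quotient_piZ scale1r. Qed.

Lemma quotient_scaleDr : right_distributive quotient_scale +%R.
Proof.
move=> a u v; rewrite -[u]quotient_reprK -[v]quotient_reprK -quotient_piD.
by rewrite !quotient_piZ scalerDr quotient_piD.
Qed.

Lemma quotient_scaleDl u : {morph quotient_scale^~ u : a b / a + b}.
Proof.
by move=> a b; rewrite -[u]quotient_reprK !quotient_piZ scalerDl quotient_piD.
Qed.

HB.instance Definition _ :=
  GRing.Zmodule_isLmodule.Build R quotient_type
    quotient_scaleA quotient_scale1 quotient_scaleDr quotient_scaleDl.

Lemma quotient_pi_linear : linear quotient_pi.
Proof. by move=> a x y; rewrite quotient_piD -quotient_piZ. Qed.

Lemma quotient_ex : exists (Q : lmodType R) (q : {linear M -> Q}),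
  (forall y, exists x, q x = y) /\ forall x, q x = 0 <-> P x.
Proof.
exists quotient_type, (linear_of quotient_pi_linear); split=> [y|x].
  by exists (repr y); apply: quotient_reprK.
have e0 : linear_of quotient_pi_linear 0 = 0 by apply: raddf0.
by rewrite -e0 -[x in P x]subr0; apply: quotient_pi_eq.
Qed.

End Subquotient.

Section Product.
Variables (n : nat) (W : 'I_n -> lmodType R).

Definition dprod := forall k, W k.

HB.instance Definition _ := gen_eqMixin dprod.
HB.instance Definition _ := gen_choiceMixin dprod.

Let dext (x y : dprod) : (forall k, x k = y k) -> x = y :=
  @functional_extensionality_dep _ _ x y.

Definition dprod_zero : dprod := fun=> 0.
Definition dprod_add (x y : dprod) : dprod := fun k => x k + y k.
Definition dprod_opp (x : dprod) : dprod := fun k => - x k.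
Definition dprod_scale (a : R) (x : dprod) : dprod := fun k => a *: x k.

Lemma dprod_addA : associative dprod_add.
Proof. by move=> x y z; apply: dext => k; apply: addrA. Qed.
Lemma dprod_addC : commutative dprod_add.
Proof. by move=> x y; apply: dext => k; apply: addrC. Qed.
Lemma dprod_add0 : left_id dprod_zero dprod_add.
Proof. by move=> x; apply: dext => k; apply: add0r. Qed.
Lemma dprod_addN : left_inverse dprod_zero dprod_opp dprod_add.
Proof. by move=> x; apply: dext => k; apply: addNr. Qed.

HB.instance Definition _ := GRing.isZmodule.Build dprod
  dprod_addA dprod_addC dprod_add0 dprod_addN.

Lemma dprod_scaleA a b x : dprod_scale a (dprod_scale b x) = dprod_scale (a * b) x.
Proof. by apply: dext => k; apply: scalerA. Qed.
Lemma dprod_scale1 : left_id 1 dprod_scale.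
Proof. by move=> x; apply: dext => k; apply: scale1r. Qed.
Lemma dprod_scaleDr : right_distributive dprod_scale +%R.
Proof. by move=> a x y; apply: dext => k; apply: scalerDr. Qed.
Lemma dprod_scaleDl x : {morph dprod_scale^~ x : a b / a + b}.
Proof. by move=> a b; apply: dext => k; apply: scalerDl. Qed.

HB.instance Definition _ := GRing.Zmodule_isLmodule.Build R dprod
  dprod_scaleA dprod_scale1 dprod_scaleDr dprod_scaleDl.

(** The family with entry x at k and 0 elsewhere. *)
Definition dprod_inj k (x : W k) : dprod :=
  @dfwith _ (fun l => W l : Type) (fun l => 0 : W l) k x.
Definition dprod_proj k (x : dprod) : W k := x k.

Lemma dprod_inj_linear k : linear (@dprod_inj k).
Proof.
move=> a x y; apply: dext => l; rewrite [RHS]/(a *: dprod_inj x l + dprod_inj y l).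
rewrite /dprod_inj; have [<-|kl] := eqVneq k l; first by rewrite !dfwith_in.
rewrite !dfwith_out // -[RHS]/(a *: (0 : W l) + (0 : W l)) scaler0.
by rewrite addr0.
Qed.

Lemma dprod_proj_linear k : linear (@dprod_proj k). Proof. by []. Qed.

Lemma dprod_injK k (x : W k) : dprod_proj k (dprod_inj x) = x.
Proof. exact: dfwith_in. Qed.

Lemma dprod_inj0 k l (x : W k) : k != l -> dprod_proj l (dprod_inj x) = 0.
Proof. by move=> kl; rewrite /dprod_proj /dprod_inj dfwith_out. Qed.

Lemma dprod_sum (x : dprod) : x = \sum_k dprod_inj (dprod_proj k x).
Proof.
apply: dext => l; have pD : {morph @dprod_proj l : y z / y + z} by [].
have p0 : @dprod_proj l 0 = 0 by [].
rewrite -[RHS]/(dprod_proj l _) (big_morph _ pD p0) (bigD1 l) //= dprod_injK.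
by rewrite big1 ?addr0 // => k kl; rewrite dprod_inj0.
Qed.

End Product.

Lemma fin_gen_fam (T : finType) (M : lmodType R) (t : T -> M) :
  (forall m, exists c : T -> R, m = \sum_i c i *: t i) -> fin_gen M.
Proof.
move=> tP; exists [seq t i | i <- enum T] => m; have [c ->] := tP m.
have sz : size [seq t i | i <- enum T] = #|T| by rewrite size_map cardE.
exists (fun i => c (enum_val (cast_ord sz i))).
rewrite (reindex (fun i => enum_val (cast_ord sz i))) /=; last first.
  apply: onW_bij; apply: bij_comp (enum_val_bij T) _.
  by exists (cast_ord (esym sz)); [apply: cast_ordK|apply: cast_ordKV].
apply: eq_bigr => i _; congr (_ *: _).
rewrite (nth_map (enum_val (cast_ord sz i))).
  by congr (t _); rewrite -(enum_val_nth _ (cast_ord sz i)).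
by rewrite -cardE; apply: ltn_ord (cast_ord sz i).
Qed.

Lemma fin_gen_surj (M N : lmodType R) (f : {linear M -> N}) :
  (forall n, exists m, f m = n) -> fin_gen M -> fin_gen N.
Proof.
move=> fS [s sP]; apply: (@fin_gen_fam _ _ (fun i : 'I_(size s) => f s`_i)) => m.
have [x <-] := fS m; have [c ->] := sP x; exists c.
by rewrite linear_sum; apply: eq_bigr => i _; rewrite linearZ_LR.
Qed.

Lemma fin_gen_dprod n (W : 'I_n -> lmodType R) :
  (forall k, fin_gen (W k)) -> fin_gen (dprod W).
Proof.
move=> /(_ _)/cid-/all_sig[s sP].
pose T := {k : 'I_n & 'I_(size (s k))}.
apply: (@fin_gen_fam T _ (fun i => dprod_inj (s (tag i))`_(tagged i))) => m.
have /all_sig[c cP] k := cid (sP k (m k)).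
exists (fun i => c (tag i) (tagged i)).
rewrite [LHS]dprod_sum (eq_bigr (fun k => \sum_(i < size (s k))
    c k i *: dprod_inj (s k)`_i)); first by rewrite sig_big_dep.
move=> k _; rewrite /dprod_proj (cP k).
rewrite -[LHS]/(linear_of (@dprod_inj_linear n W k) _) linear_sum.
by apply: eq_bigr => i _; rewrite linearZ_LR.
Qed.

End LinearMaps.

Section ModEndAbelian.
Variables (K : fieldType) (C : linCat K) (I : C).
Hypothesis Ifin : fin_gen (hom I I).

Local Notation R := (endo I)^c.
Local Notation scalI := (scal I).

Lemma scalD a b : scalI (a + b) = scalI a + scalI b.
Proof. exact: scalerDl. Qed.

Lemma scal0 : scalI 0 = 0.
Proof. exact: scale0r. Qed.

Lemma scal_mul (a : K) (e : hom I I) : (scalI a : R) * (e : R) = (a *: e : hom I I).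
Proof.
rewrite [LHS](_ : _ = e \om (a *: idm I)) //.
by rewrite compZr compm1.
Qed.

Lemma fin_gen_scal (M : rmodule I) : fin_gen M ->
  exists (n : nat) (t : 'I_n -> M),
    forall m, exists c : 'I_n -> K, m = \sum_k scalI (c k) *: t k.
Proof.
move=> [s sP]; have [e eP] := Ifin.
pose T := ('I_(size s) * 'I_(size e))%type.
pose t (p : T) : M := (e`_(p.2) : R) *: s`_(p.1).
have tP m : exists c : T -> K, m = \sum_p scalI (c p) *: t p.
  have [c ->] := sP m; have /all_sig[d dP] i := cid (eP (c i)).
  exists (fun p => d p.1 p.2).
  rewrite -(pair_bigA_idem _ (fun i j => scalI (d i j) *: t (i, j))) /=; last exact: addr0.
  apply: eq_bigr => i _; rewrite [in LHS](dP i) scaler_suml.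
  by apply: eq_bigr => j _; rewrite -scal_mul -scalerA.
exists #|{: T}|, (fun k => t (enum_val k)) => m; have [c ->] := tP m.
exists (fun k => c (enum_val k)).
rewrite (reindex (fun k : 'I_#|{: T}| => enum_val k)) //.
by apply: onW_bij; apply: enum_val_bij.
Qed.

(** End(I) is finite dimensional, so M is a quotient of some K^n by a K-linear
theta; a matrix of maximal rank among those whose rows map into P spans the
preimage of P. *)
Lemma fin_gen_submodule (M : rmodule I) (P : submodule M) : fin_gen M ->
  exists (n : nat) (t : 'I_n -> M), (forall k, P (t k)) /\
    forall m, P m -> exists c : 'I_n -> R, m = \sum_k c k *: t k.
Proof.
move=> /fin_gen_scal [n [t tP]].
pose theta (v : 'rV[K]_n) : M := \sum_k scalI (v 0 k) *: t k.
have thetaD a v w : theta (a *: v + w) = scalI a *: theta v + theta w.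
  rewrite scaler_sumr -big_split; apply: eq_bigr => k _ /=.
  by rewrite !mxE scalD scalerDl -(scalM I) scalerA.
have theta0 : theta 0 = 0.
  by rewrite /theta big1 // => k _; rewrite mxE scal0 scale0r.
pose inP m (A : 'M[K]_(m, n)) := forall i, P (theta (row i A)).
have inP_mul m1 m2 (B : 'M_(m1, m2)) (A : 'M_(m2, n)) : inP _ A -> inP _ (B *m A).
  move=> PA i; rewrite row_mul mulmx_sum_row.
  elim/big_rec: _ => [|k v _ Pv]; first by rewrite theta0; apply: submodule0.
  by rewrite thetaD; apply: submoduleP.
have thetaM m (v : 'rV_m) (A : 'M_(m, n)) :
    theta (v *m A) = \sum_k scalI (v 0 k) *: theta (row k A).
  rewrite mulmx_sum_row.
  elim/big_rec2: _ => [|k x y _ <-]; first exact: theta0.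
  by rewrite thetaD.
pose rk r := `[< exists m (A : 'M[K]_(m, n)), inP _ A /\ \rank A = r >].
have rk0 : exists r, rk r.
  exists 0%N; apply/asboolP; exists 0%N, 0; split; last exact: mxrank0.
  by case.
have rkn r : rk r -> (r <= n)%N.
  by move=> /asboolP [m [A [_ <-]]]; apply: rank_leq_col.
case: (ex_maxnP rk0 rkn) => r /asboolP [m [A [PA rA]]] rmax.
exists m, (fun k => theta (row k A)); split=> // x Px.
have [c Ec] := tP x; pose v : 'rV_n := \row_k c k.
have Ev : theta v = x by rewrite Ec; apply: eq_bigr => k _; rewrite mxE.
suff /submxP [D vDA] : (v <= A)%MS.
  by exists (fun k => scalI (D 0 k)); rewrite -Ev vDA thetaM.
(* Adding the row v cannot increase the rank, so v is in the row space of A. *)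
have PvA : inP _ (col_mx A v).
  move=> i; rewrite -(splitK i); case: (split i) => j /=; first by rewrite rowKu.
  by rewrite rowKd row_id Ev.
have: rk (\rank (col_mx A v)) by apply/asboolP; exists (m + 1)%N, (col_mx A v).
move=> /rmax; rewrite -rA -addsmxE => le.
have sA : (A <= A + v)%MS := addsmxSl A v.
apply: submx_trans (addsmxSr A v) _.
by rewrite -(geq_leqif (mxrank_leqif_sup sA)).
Qed.

Lemma mhom_sumE (M N : rmodule I) n (f : 'I_n -> mhom M N) (x : M) :
  (\sum_k f k : mhom M N) x = \sum_k (f k : mhom M N) x.
Proof. exact: (big_morph (fun g : mhom M N => g x)). Qed.

Lemma fin_gen_sub (M S : rmodule I) (v : {linear S -> M}) :
  injective v -> fin_gen M -> fin_gen S.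
Proof.
move=> vI Mfin.
have P0 : exists s, v s = 0 by exists 0; rewrite raddf0.
have PL a x y : (exists s, v s = x) -> (exists s, v s = y) ->
    exists s, v s = a *: x + y.
  by move=> [s <-] [u <-]; exists (a *: s + u); rewrite linearP.
have [n [t [/(_ _)/cid-/all_sig[u uP] tP]]] :=
  fin_gen_submodule (Submodule P0 PL) Mfin.
apply: (fin_gen_fam (t := u)) => s.
have [|c Ec] := tP (v s); first by exists s.
exists c; apply: vI; rewrite Ec linear_sum; apply: eq_bigr => k _.
by rewrite linearZ uP.
Qed.

Definition ker_submodule (M N : rmodule I) (f : {linear M -> N}) : submodule M.
Proof.
exists (fun x => f x = 0); first exact: raddf0.
by move=> a x y fx fy; rewrite linearP fx fy scaler0 addr0.
Defined.

Definition im_submodule (M N : rmodule I) (f : {linear M -> N}) : submodule N.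
Proof.
exists (fun y => exists x, f x = y); first by exists 0; rewrite raddf0.
by move=> a _ _ [x <-] [y <-]; exists (a *: x + y); rewrite linearP.
Defined.

Lemma mod_kernel_of (A M N : mod_End I) (k : hom A M) (f : hom M N) :
  injective (k : {linear sval A -> sval M}) ->
  (forall x, (f : {linear sval M -> sval N}) x = 0 <->
     exists a, (k : {linear sval A -> sval M}) a = x) ->
  is_kernel k f.
Proof.
move=> kI kf; split.
  by apply: mhom_ext => a; apply/kf; exists a.
move=> T g fg0.
have [|u uP] := factor_through_injective (g := (g : {linear sval T -> sval M})) kI.
  move=> t; apply/kf.
  exact: (congr1 (fun h : mhom (sval T) (sval N) => h t) fg0).
exists u; split; first by apply: mhom_ext => t; apply: uP.
move=> w kw; apply: mhom_ext => t; apply: kI; rewrite uP.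
by rewrite -(congr1 (fun h : mhom (sval T) (sval M) => h t) kw).
Qed.

Lemma mod_cokernel_of (M N B : mod_End I) (f : hom M N) (c : hom N B) :
  (forall b, exists n, (c : {linear sval N -> sval B}) n = b) ->
  (forall n, (c : {linear sval N -> sval B}) n = 0 <->
     exists m, (f : {linear sval M -> sval N}) m = n) ->
  is_cokernel f c.
Proof.
move=> cS cf; split.
  by apply: mhom_ext => a; apply/cf; exists a.
move=> T g gf0.
have [|u uP] := factor_through_surjective (g := (g : {linear sval N -> sval T})) cS.
  move=> n /cf [m <-].
  exact: (congr1 (fun h : mhom (sval M) (sval T) => h m) gf0).
exists u; split; first by apply: mhom_ext => t; apply: uP.
move=> w kw; apply: mhom_ext => b; have [n <-] := cS b; rewrite uP.
by rewrite -(congr1 (fun h : mhom (sval N) (sval T) => h n) kw).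
Qed.

Lemma mod_kernel (M N : mod_End I) (f : hom M N) :
  exists (A : mod_End I) (k : hom A M),
    injective (k : {linear sval A -> sval M}) /\
    forall x, (f : {linear sval M -> sval N}) x = 0 <->
      exists a, (k : {linear sval A -> sval M}) a = x.
Proof.
have [S [v [vI vP]]] := submodule_ex (ker_submodule (f : {linear sval M -> sval N})).
by exists (exist _ S (fin_gen_sub vI (svalP M))), v.
Qed.

Lemma mod_cokernel (M N : mod_End I) (f : hom M N) :
  exists (B : mod_End I) (c : hom N B),
    (forall b, exists n, (c : {linear sval N -> sval B}) n = b) /\
    forall n, (c : {linear sval N -> sval B}) n = 0 <->
      exists m, (f : {linear sval M -> sval N}) m = n.
Proof.
have [Q [q [qS qP]]] := quotient_ex (im_submodule (f : {linear sval M -> sval N})).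
by exists (exist _ Q (fin_gen_surj qS (svalP N))), q.
Qed.

Lemma mod_End_additive : additive_cat (mod_End I).
Proof.
move=> n W; pose V k := sval (W k) : rmodule I.
exists (exist _ (dprod V : rmodule I) (fin_gen_dprod (fun k => svalP (W k)))).
exists (fun k => linear_of (@dprod_inj_linear R n V k) : {linear V k -> dprod V}).
exists (fun k => linear_of (@dprod_proj_linear R n V k) : {linear dprod V -> V k}).
split=> [k|k l kl|]; apply: mhom_ext => x.
- exact: dprod_injK.
- exact: dprod_inj0.
- by rewrite mhom_sumE [RHS]dprod_sum.
Qed.

(** A mono has zero kernel, so it is injective and is the kernel of its cokernel;
dually for an epi. *)
Theorem mod_End_abelian : abelian_cat (mod_End I).
Proof.
split.
- exact: mod_End_additive.
- move=> M N f; have [A [k [kI kf]]] := mod_kernel f.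
  by exists A, k; apply: mod_kernel_of.
- move=> M N f; have [B [c [cS cf]]] := mod_cokernel f.
  by exists B, c; apply: mod_cokernel_of.
- move=> M N f fm; have [B [c [_ cf]]] := mod_cokernel f.
  exists B, c; apply: mod_kernel_of cf.
  have [A [k [kI kf]]] := mod_kernel f.
  have k0 : k = 0.
    apply: fm; rewrite compm0; apply: mhom_ext => a; apply/kf; by exists a.
  apply: raddf_inj => x /kf [a <-]; rewrite k0; exact: erefl.
- move=> M N f fe; have [A [k [_ kf]]] := mod_kernel f.
  exists A, k; apply: mod_cokernel_of kf.
  have [B [c [_ cf]]] := mod_cokernel f.
  have c0 : c = 0.
    apply: fe; rewrite comp0m; apply: mhom_ext => a; apply/cf; by exists a.
  by move=> n; apply/cf; rewrite c0.
Qed.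

End ModEndAbelian.

(** * The equivalence *)

Section Corestriction.
Variables (K : fieldType) (C D : linCat K).

Definition inclF (P : C -> Prop) : linFunctor (fullsub P) C :=
  @LinFunctor K (fullsub P) C sval (fun X Y => idfun) (fun _ => erefl)
    (fun _ _ _ _ _ => erefl).

Variables (F : linFunctor C D) (P : D -> Prop) (FP : forall X : C, P (F X)).

Definition corestrF : linFunctor C (fullsub P) :=
  @LinFunctor K C (fullsub P) (fun X => exist P (F X) (FP X))
    (fun X Y => fmap F) (fmap_id F) (@fmap_comp K C D F).

End Corestriction.

Section HomModule.
Variables (K : fieldType) (C : linCat K) (I : C).
Local Notation R := (endo I)^c.

Definition hom_module (T : C) : Type := hom I T.

HB.instance Definition _ (T : C) := GRing.Zmodule.copy (hom_module T) (hom I T).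

Definition hom_module_scale (T : C) (e : R) (x : hom_module T) : hom_module T :=
  (x : hom I T) \om (e : hom I I).

Lemma hom_module_scaleA (T : C) a b (x : hom_module T) :
  hom_module_scale a (hom_module_scale b x) = hom_module_scale (a * b) x.
Proof. by rewrite /hom_module_scale -compA. Qed.
Lemma hom_module_scale1 (T : C) : left_id 1 (@hom_module_scale T).
Proof. by move=> x; apply: compm1. Qed.
Lemma hom_module_scaleDr (T : C) : right_distributive (@hom_module_scale T) +%R.
Proof. by move=> a x y; apply: compDl. Qed.
Lemma hom_module_scaleDl (T : C) (x : hom_module T) :
  {morph (@hom_module_scale T)^~ x : a b / a + b}.
Proof. by move=> a b; apply: compDr. Qed.

HB.instance Definition _ (T : C) :=
  GRing.Zmodule_isLmodule.Build R (hom_module T)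
    (@hom_module_scaleA T) (@hom_module_scale1 T) (@hom_module_scaleDr T)
    (@hom_module_scaleDl T).

Definition hom_module_map (T U : C) (f : hom T U) (x : hom_module T) : hom_module U :=
  f \om (x : hom I T).

Lemma hom_module_map_linear (T U : C) (f : hom T U) : linear (hom_module_map f).
Proof.
move=> a x y; rewrite [LHS]compDr; congr (_ + _).
exact: compA.
Qed.

Definition hom_module_mhom (T U : C) (f : hom T U) :
    mhom (hom_module T : rmodule I) (hom_module U) :=
  linear_of (hom_module_map_linear f) : {linear hom_module T -> hom_module U}.

Lemma hom_module_mhom_linear (T U : C) : linear (@hom_module_mhom T U).
Proof.
move=> a f g; apply: mhom_ext => x.
rewrite [LHS]compDl; congr (_ + _).
by rewrite [LHS]compZl [RHS](compZr a) compm1.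
Qed.

HB.instance Definition _ (T U : C) :=
  GRing.isLinear.Build K (hom T U) (mhom (hom_module T : rmodule I) (hom_module U))
    *:%R (@hom_module_mhom T U) (@hom_module_mhom_linear T U).

Lemma hom_module_id (T : C) :
  hom_module_mhom (idm T) = mhom_id (hom_module T : rmodule I).
Proof. by apply: mhom_ext => x; apply: comp1m. Qed.

Lemma hom_module_comp (T U V : C) (g : hom U V) (f : hom T U) :
  hom_module_mhom (g \om f) = mhom_comp (hom_module_mhom g) (hom_module_mhom f).
Proof. by apply: mhom_ext => x; apply/esym/compA. Qed.

Definition homF : linFunctor C (rmod_cat I) :=
  @LinFunctor K C (rmod_cat I) (fun T => hom_module T : rmodule I)
    (fun T U => (@hom_module_mhom T U : {linear _ -> _})) hom_module_id hom_module_comp.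

Lemma fin_gen_hom_module (T : C) : fin_gen (hom I T) -> fin_gen (hom_module T).
Proof.
move=> [s sP]; apply: (@fin_gen_fam _ _ _ (fun i : 'I_(size s) => s`_i : hom_module T)).
move=> m; have [c ->] := sP m; exists (fun i => scal I (c i)).
by apply: eq_bigr => i _; rewrite [RHS](compZr (c i)) compm1.
Qed.

End HomModule.

Section HeartFunctor.
Variables (K : fieldType) (C : triCat K) (CY : calabi_yau2 C).
Variables (X Y : subcat C) (XY : cotorsion_pair X Y).
Hypotheses (CKS : krull_schmidt C) (Cfinite : finite_cat C) (Cfin : hom_finite C).
Variable I : C.
Hypothesis coreI : forall M : C, core X Y M <-> add_closure I M.

Local Notation R := (endo I)^c.
Local Notation HF := (compF (homF I) (compF (shift C) (inclF (heart_mem X Y)))).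

Lemma HF_fin_gen (M : fullsub (heart_mem X Y)) : fin_gen (HF M : rmodule I).
Proof. exact/fin_gen_hom_module/Cfin. Qed.

Definition heart_to_mod : linFunctor (fullsub (heart_mem X Y)) (mod_End I) :=
  corestrF HF_fin_gen.

Lemma heart_to_mod_eq0 (M N : fullsub (heart_mem X Y)) (f : hom M N) :
  fmap heart_to_mod f = 0 <->
  imem (ideal_restr (factor_ideal (@tadd K C) (core X Y)) (heart_mem X Y)) f.
Proof.
have [HM _] := svalP M; have [_ HN] := svalP N.
split=> [f0|Jf].
  apply: (heart_hom_faithful CY XY CKS Cfinite Cfin coreI) => // x.
  exact: (congr1 (fun h : mhom (hom_module I _) (hom_module I _) => h x) f0).
apply: mhom_ext => x; exact: (factors_shift_eq0 XY coreI Jf).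
Qed.

Lemma heart_to_mod_full : full heart_to_mod.
Proof.
move=> M N h; have [HM _] := svalP M; have [_ HN] := svalP N.
pose h' : {linear hom_module I ((sval M)[+1]) -> hom_module I ((sval N)[+1])} := h.
pose phi : hom I ((sval M)[+1]) -> hom I ((sval N)[+1]) := h'.
have phiD : {morph phi : x y / x + y} := raddfD h'.
have phiM x (e : hom I I) : phi (x \om e) = phi x \om e := linearZ_LR h' (e : R) x.
have [f fP] := heart_hom_full CY XY CKS Cfinite Cfin coreI phiD phiM HM HN.
by exists f; apply: mhom_ext => x; rewrite -[RHS]/(phi x) fP.
Qed.

(** Generators of N and of the kernel of the resulting Hom(I, J0) -> N give a
morphism J1 -> J0 presenting N. *)
Lemma heart_to_mod_ess_surj : ess_surj heart_to_mod.
Proof.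
move=> [N [s sP]].
have [J0 IJ0] := tadd (fun _ : 'I_(size s) => I).
have [i0 [p0 [pi0 pi00 _]]] := IJ0.
have rhoL : linear (fun u : hom_module I J0 =>
    \sum_k ((p0 k \om (u : hom I J0) : hom I I) : R) *: s`_k : N).
  move=> e x y; rewrite scaler_sumr -big_split; apply: eq_bigr => k _ /=.
  rewrite scalerA -scalerDl; congr (_ *: _).
  by rewrite [LHS]compDr; congr (_ + _); apply: compA.
pose rho := linear_of rhoL : {linear hom_module I J0 -> N}.
have rhoS n : exists u, rho u = n.
  have [c ->] := sP n; exists (\sum_k i0 k \om (c k : hom I I)).
  apply: eq_bigr => k _; congr (_ *: _).
  rewrite [LHS]comp_sumr (bigD1 k) //= big1 ?addr0 => [|l lk].
    by rewrite compA pi0 comp1m.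
  by rewrite compA pi00 // comp0m.
have [m [t [t0 tP]]] := fin_gen_submodule (Cfin I I) (ker_submodule rho)
  (fin_gen_hom_module (Cfin I J0)).
have [J1 IJ1] := tadd (fun _ : 'I_m => I).
have [i1 [p1 [pi1 pi10 _]]] := IJ1.
pose a : hom J1 J0 := \sum_k (t k : hom I J0) \om p1 k.
have [M [c [HM ca0 cS cK]]] := heart_presentation CY XY coreI a
  (core_powers coreI IJ1) (core_powers coreI IJ0).
pose gam := hom_module_mhom I c : {linear hom_module I J0 -> hom_module I (M[+1])}.
have gamS x : exists u, gam u = x by have [u ->] := cS x; exists u.
(* gam and rho are surjections from Hom(I, J0) with the same kernel *)
have gr u : gam u = 0 -> rho u = 0.
  move=> /cK [v ->]; rewrite [X in rho X]comp_suml raddf_sum big1 // => k _.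
  rewrite -compA; transitivity (rho ((p1 k \om v : R) *: t k)); first by [].
  by rewrite linearZ /= [rho _]t0 scaler0.
have rg u : rho u = 0 -> gam u = 0.
  move=> /tP [d ->]; rewrite [LHS](_ : _ = c \om (a \om \sum_k (i1 k \om (d k : hom I I)))).
    by rewrite compA ca0 comp0m.
  congr (c \om _); rewrite comp_suml; apply: eq_bigr => k _; rewrite comp_sumr.
  rewrite (bigD1 k) //= big1 ?addr0 => [|l lk].
    by rewrite compA -[_ \om p1 k \om _]compA pi1 compm1.
  by rewrite compA -[_ \om p1 k \om _]compA pi10 // compm0 comp0m.
have [u uP] := factor_through_surjective gamS gr.
have [v vP] := factor_through_surjective rhoS rg.
exists (exist _ M HM), u, v; split; apply: mhom_ext => x.
- by have [y <-] := gamS x; rewrite /= uP vP.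
- by have [y <-] := rhoS x; rewrite /= vP uP.
Qed.

End HeartFunctor.

Theorem proposition5p1 (K : closedFieldType) (charK : [pchar K] =i pred0)
    (C : triCat K) (Cfin : hom_finite C) (CKS : krull_schmidt C)
    (CY : calabi_yau2 C) (Cfinite : finite_cat C)
    (X Y : subcat C) (XY : cotorsion_pair X Y)
    (I : C) (Irigid : rigid I)
    (coreI : forall M : C, core X Y M <-> add_closure I M) :
  [/\ abelian_cat (heart X Y), abelian_cat (mod_End I)
    & equivalent (heart X Y) (mod_End I)].
Proof.
have mod_abelian : abelian_cat (mod_End I) := mod_End_abelian (Cfin I I).
pose F := heart_to_mod X Y Cfin I.
have F0 := heart_to_mod_eq0 CY XY CKS Cfinite Cfin coreI.
pose G : linFunctor (heart X Y) (mod_End I) :=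
  quot_lift (F := F) (fun M N f => proj2 (F0 M N f)).
have Gi : faithful G by apply: quot_lift_faithful => M N f /F0.
have Gf : full G by apply/quot_lift_full/heart_to_mod_full.
have Ge : ess_surj G by apply/quot_lift_ess_surj/heart_to_mod_ess_surj.
split=> //; first exact: abelian_transport Gi Gf Ge mod_abelian.
by exists G; apply: ff_equivalence.
Qed.
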